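(* Let $n\ge 1$ and let $\mathcal N_1$ and $\mathcal N_2$ be two Grassmann necklaces in $\binom{[n]}{r}$. Put $\mathcal I_k=\mathcal{I}nt(\mathcal N_k)$ and $\mathcal O_k=\mathcal{O}ut(\mathcal N_k)$ for $k=1,2$. Suppose that $\mathcal N_1$ is less than $\mathcal N_2$, equivalently, that every set of $\mathcal N_1$ belongs to $\mathcal I_2$. Then the system $\mathcal I_2\cap\mathcal O_1$ is pure and its rank is equal to $r(n-r)+1-rk(\mathcal I_1)-rk(\mathcal O_2)$.
   Context: $[n]=\{1,\ldots,n\}$, regarded as $\mathbb Z$ modulo $n$; $\binom{[n]}{r}$ is the set of $r$-element subsets of $[n]$. For $i\in[n]$, $<_i$ is the cyclically shifted order $i<_i i+1<_i\cdots<_i n<_i 1<_i\cdots<_i i-1$. For $X,Y\in\binom{[n]}{r}$, write $X\ll_i Y$ if $x<_i y$ for all $x\in X-Y$ and $y\in Y-X$. $X$ and $Y$ are (weakly) separated, written $X\|Y$, if $X\ll_j Y$ for some $j\in[n]$. A system $\mathcal X\subseteq\binom{[n]}{r}$ is separated if $X\|Y$ for all $X,Y\in\mathcal X$. A system $\mathcal D\subseteq\binom{[n]}{r}$ is pure if all inclusion-wise maximal separated subsystems of $\mathcal D$ have the same size; this size is called the rank of $\mathcal D$ and denoted $rk(\mathcal D)$. A (Grassmann) necklace in $\binom{[n]}{r}$ is a family $\mathcal N=(N_1,\ldots,N_n)$ of sets in $\binom{[n]}{r}$ such that $N_{i+1}\supseteq N_i-\{i\}$ for each $i$ (indices modulo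 $n$). Standing assumption: $i\in N_i$ for every $i\in[n]$. The interior of $\mathcal N$ is $\mathcal{I}nt(\mathcal N)=\{X\in\binom{[n]}{r} : N_i\ll_i X \text{ for every } i\in[n]\}$. Put $\mathcal S(\mathcal N)=\{X\in\binom{[n]}{r} : X\|N_i \text{ for all } i\in[n]\}$. One has $\mathcal{I}nt(\mathcal N)\subseteq\mathcal S(\mathcal N)$, and the exterior of $\mathcal N$ is $\mathcal{O}ut(\mathcal N)=\mathcal S(\mathcal N)\setminus\mathcal{I}nt(\mathcal N)$. The interior and the exterior of any necklace are pure systems, so their ranks are defined. A necklace $\mathcal N_1$ is less than a necklace $\mathcal N_2$ if $\mathcal{I}nt(\mathcal N_1)\subseteq\mathcal{I}nt(\mathcal N_2)$; this is equivalent to every set of $\mathcal N_1$ belonging to $\mathcal{I}nt(\mathcal N_2)$. *)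

(* Defs.v *)
From mathcomp Require Import all_boot all_order all_algebra.

Set Implicit Arguments.
Unset Strict Implicit.
Unset Printing Implicit Defensive.

(* The cyclic ground set [n] is 'I_n (elements 0, ..., n-1), with cyclic
   successor i + 1 given by [ordS i]. *)

(* x <_i y: compare the residues of x - i and y - i in {0, ..., n-1}. *)
Definition cyc_lt (n : nat) (i x y : 'I_n) : bool :=
  (x + (n - i)) %% n < (y + (n - i)) %% n.

Definition cyc_ll (n : nat) (i : 'I_n) (X Y : {set 'I_n}) : bool :=
  [forall x in X :\: Y, forall y in Y :\: X, cyc_lt i x y].

(* Weak separation; the formula is the right one only for sets of equal size,
   which is the only case used below. *)
Definition wsep (n : nat) (X Y : {set 'I_n}) : bool :=
  [exists j : 'I_n, cyc_ll j X Y].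

Definition separated (n : nat) (S : {set {set 'I_n}}) : bool :=
  [forall X in S, forall Y in S, wsep X Y].

Definition max_separated (n : nat) (D S : {set {set 'I_n}}) : bool :=
  maxset (fun S' : {set {set 'I_n}} => (S' \subset D) && separated S') S.

Definition pure (n : nat) (D : {set {set 'I_n}}) : Prop :=
  forall S S' : {set {set 'I_n}},
    max_separated D S -> max_separated D S' -> #|S| = #|S'|.

(* For pure D this is the common size of the maximal separated subsystems
   (lemma [rk_pure]); the value is only meaningful in that case. *)
Definition rk (n : nat) (D : {set {set 'I_n}}) : nat :=
  \max_(S : {set {set 'I_n}} | max_separated D S) #|S|.

Lemma rk_pure (n : nat) (D S : {set {set 'I_n}}) :
  pure D -> max_separated D S -> rk D = #|S|.
Proof.
move=> pD mS; apply/eqP; rewrite eqn_leq; apply/andP; split.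
  by apply/bigmax_leqP => S' mS'; rewrite (pD _ _ mS' mS).
by rewrite /rk (bigD1 S) //= leq_maxl.
Qed.

Lemma max_separated_exists (n : nat) (D : {set {set 'I_n}}) :
  exists S, max_separated D S.
Proof.
have H0 : (set0 \subset D) && separated (set0 : {set {set 'I_n}}).
  by rewrite sub0set; apply/forall_inP => X; rewrite inE.
have [S mS _] := maxset_exists
  (P := fun S' : {set {set 'I_n}} => (S' \subset D) && separated S') H0.
by exists S.
Qed.

Definition necklace (n r : nat) (N : 'I_n -> {set 'I_n}) : Prop :=
  (forall i, #|N i| = r) /\ (forall i, N i :\ i \subset N (ordS i)).

Definition Int (n r : nat) (N : 'I_n -> {set 'I_n}) : {set {set 'I_n}} :=
  [set X : {set 'I_n} | (#|X| == r) && [forall i, cyc_ll i (N i) X]].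

Definition Sep (n r : nat) (N : 'I_n -> {set 'I_n}) : {set {set 'I_n}} :=
  [set X : {set 'I_n} | (#|X| == r) && [forall i, wsep X (N i)]].

Definition Out (n r : nat) (N : 'I_n -> {set 'I_n}) : {set {set 'I_n}} :=
  Sep r N :\: Int r N.

Definition necklace_le (n r : nat) (N1 N2 : 'I_n -> {set 'I_n}) : bool :=
  Int r N1 \subset Int r N2.

(* Main.v *)
Require Import Defs.
From mathcomp Require Import all_boot all_order all_algebra zify.

Set Implicit Arguments.
Unset Strict Implicit.
Unset Printing Implicit Defensive.

(* Let A, S and B be maximal separated subsystems of I_1, of I_2 :&: O_1 and of
   O_2.  A set in the interior of a necklace is separated from every set in its
   exterior, and the members of both necklaces belong to A :|: S, so A :|: S :|: B
   is a maximal separated system of r-sets.  By the purity of the system of all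
   r-sets, #|A| + #|S| + #|B| = r (n - r) + 1; as A, S and B vary independently,
   the three systems are pure and the rank formula follows.

   Purity of all r-sets.  Sets of different sizes are allowed, in an interval of
   sizes, and the maximum m of the ground set is deleted.  A maximal family W is
   recorded by L = {X in W | m notin X} and R = {X | m notin X, m |: X in W}.  On
   each level some set lies between L and R, hence in L :&: R; these sets force
   L :|: R to be maximal on the smaller ground set, and
   #|W| = #|L :|: R| + #|L :&: R|.

   Interior against exterior.  Suppose that Y is separated from each N_i, so that
   the cyclic order has a gap w_i after which all of N_i :\: Y comes before all
   of Y :\: N_i; this gap can be followed when i increases by 1.  If some X in the
   interior is not separated from Y, the gap makes exactly one turn per period;
   if Y is not in the interior, it makes none. *)

(** * Weak separation of sets of different sizes *)

(** Deleting the maximum turns sets of one size r into sets of sizes r and r - 1, so the induction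
    must admit an interval [lo, hi] of sizes, which becomes [lo - 1, min(hi, |G| - 1)]. The relation
    [tri] from [L] to [R] is not symmetric, and on sets of equal size it is the antisymmetric
    [below]; this leaves exactly one member of [L :&: R] on each of the hi - lo levels, and the
    count depends on lo, hi and |G| only. Sets between [L] and [R] are found at the other end of the
    order, by induction on deleting the minimum. A gap is known only up to multiples of n and up to
    places that no signed element separates, so positions are integers, and one turn means a shift
    by n. It can be followed because a single gap serves two consecutive necklace sets at once. Each
    estimate of its movement carries a bounded error, hence the comparison over several periods:
    three turns move the gap by more than 2n, while a gap that makes no turn stays in a window of
    length 2n. *)

Lemma card_exD (T : finType) (A B : {set T}) : #|A| < #|B| ->
  exists x, (x \in B) && (x \notin A).
Proof.
move=> ltAB; have: ~~ (B \subset A) by apply/negP => /subset_leq_card; lia.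
by case/subsetPn => x xB xA; exists x; rewrite xB.
Qed.

Lemma card_exDx (T : finType) (A B : {set T}) (x : T) : #|A| <= #|B| ->
  x \in A -> x \notin B -> exists y, (y \in B) && (y \notin A).
Proof.
move=> leAB xA xB; have: ~~ (B \subset A).
  apply/negP => sBA; have eBA: B = A by apply/eqP; rewrite eqEcard sBA.
  by rewrite eBA xA in xB.
by case/subsetPn => y yB yA; exists y; rewrite yB.
Qed.

(** One element of [A] outside [B] would not suffice, as [A] may be [B] with that element added; the
    second exceeds the allowed surplus. *)
Lemma card_exDxx (T : finType) (A B : {set T}) (x y : T) : #|A| <= #|B|.+1 ->
  x \in A -> x \notin B -> y \in A -> y \notin B -> x != y ->
  exists z, (z \in B) && (z \notin A).
Proof.
move=> leAB xA xB yA yB xy; have: ~~ (B \subset A).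
  apply/negP => sBA.
  have /subset_leq_card: x |: (y |: B) \subset A.
    by rewrite !subUset !sub1set xA yA.
  by rewrite !cardsU1 !inE (negbTE xy) (negbTE xB) yB /=; lia.
by case/subsetPn => z zB zA; exists z; rewrite zB.
Qed.

Ltac mem_known := repeat match goal with
  | H : is_true (?x \in ?A) |- context [?x \in ?A] => rewrite H
  | H : is_true (?x \notin ?A) |- context [?x \in ?A] => rewrite (negbTE H)
  end.

Ltac mem_cases :=
  match goal with |- context [?x \in ?A] => case: (x \in A) => /=; try done; mem_cases
  | _ => idtac end.

Ltac nlia := repeat match goal with
  | H : is_true ?b |- _ => lazymatch b with leq _ _ => fail | _ => clear H end
  | H : injective _ |- _ => clear H
  end; lia.

(** Ends arguments in which instances of [belowE] and [surrE] at a few named points stand before the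
    goal: known memberships are substituted, the others split into cases, and the order conditions
    left go to [lia]. *)
Ltac chase := mem_known; rewrite /=; try done; mem_cases; try (clear; intros; lia).

Section LinearOrder.
Variables (T : finType) (f : T -> nat).
Hypothesis f_inj : injective f.
Implicit Types (A B G X Y Z S : {set T}) (L R W : {set {set T}}).

Definition below A B : bool :=
  [forall x in A :\: B, forall y in B :\: A, f x < f y].

Definition surr A B : bool :=
  [forall b in B :\: A, forall a in A :\: B, forall b' in B :\: A,
    (f a < f b) || (f b' < f a)].

(** The boolean implication lets rewriting with memberships reduce an instance to its order
    condition or to a triviality. *)
Lemma belowE x y A B : below A B ->
  [&& x \in A, x \notin B, y \in B & y \notin A] ==> (f x < f y).
Proof.
move=> /forall_inP bAB; apply/implyP => /and4P[xA xB yB yA].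
have /forall_inP -> // : [forall y in B :\: A, f x < f y].
  by apply: bAB; rewrite inE xA xB.
by rewrite inE yA yB.
Qed.

Lemma surrE b a b' A B : surr A B ->
  [&& a \in A, a \notin B, b \in B, b \notin A, b' \in B & b' \notin A] ==>
  ((f a < f b) || (f b' < f a)).
Proof.
move=> /forall_inP sAB; apply/implyP => /and5P[aA aB bB bA /andP[b'B b'A]].
move: (sAB b); rewrite inE bA bB => /(_ isT)/forall_inP/(_ a).
rewrite inE aA aB => /(_ isT)/forall_inP/(_ b').
by rewrite inE b'A b'B => /(_ isT).
Qed.

Lemma f_lt x y A : x \in A -> y \notin A -> ~~ (f x < f y) -> f y < f x.
Proof.
move=> xA yA; have [//|//|/f_inj xy] := ltngtP (f x) (f y).
by rewrite xy (negbTE yA) in xA.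
Qed.

Lemma belowN A B : ~~ below A B -> exists x y,
  [&& x \in A, x \notin B, y \in B, y \notin A & f y < f x].
Proof.
rewrite negb_forall => /existsP[x]; rewrite negb_imply !inE => /andP[/andP[xB xA]].
rewrite negb_forall => /existsP[y]; rewrite negb_imply !inE.
move=> /andP[/andP[yA yB] xy].
by exists x, y; rewrite xA xB yA yB (f_lt xA yA xy).
Qed.

Lemma surrN A B : ~~ surr A B -> exists b a b',
  [&& a \in A, a \notin B, b \in B, b \notin A, b' \in B, b' \notin A &
   f b < f a < f b'].
Proof.
rewrite negb_forall => /existsP[b]; rewrite negb_imply !inE => /andP[/andP[bA bB]].
rewrite negb_forall => /existsP[a]; rewrite negb_imply !inE => /andP[/andP[aB aA]].
rewrite negb_forall => /existsP[b']; rewrite negb_imply !inE negb_or.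
move=> /andP[/andP[b'A b'B] /andP[ab ba]].
exists b, a, b'; rewrite aA aB bA bB b'A b'B (f_lt aA bA ab) /=.
by apply: (f_lt b'B) => //; rewrite aB.
Qed.

(* [tri X Y] amounts to [wsl X (m |: Y)] for [m] above all elements of [X] and
   [Y]; see [wsl_max]. *)
Definition tri X Y : bool := if #|X| <= #|Y| then below X Y else surr Y X.

(* Leclerc and Zelevinsky's weak separation: the surrounding set is not larger. *)
Definition wsl X Y : bool :=
  ((#|X| <= #|Y|) && surr X Y) || ((#|Y| <= #|X|) && surr Y X).

Lemma below_surr X Y : below X Y -> surr X Y.
Proof.
move=> bXY; apply/negPn/negP => /surrN[b [a [b']]].
have := belowE a b bXY; have := belowE a b' bXY; lia.
Qed.

Lemma below_surrC X Y : below X Y -> surr Y X.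
Proof.
move=> bXY; apply/negPn/negP => /surrN[b [a [b']]].
have := belowE b a bXY; have := belowE b' a bXY; lia.
Qed.

Lemma tri_wsl X Y : tri X Y -> wsl X Y.
Proof.
rewrite /tri /wsl; case: (leqP #|X| #|Y|) => [le /below_surr -> // | lt ->].
by rewrite (ltnW lt).
Qed.

(* In [ex_between], where [e] is the minimum of the ground set, a member [X] of
   the cut obstructs [e |: Z1] and a member [e |: Y] obstructs [Z].  The letters in
   the names of this and the next three lemmas tell the sides of the cut on which
   the two obstructions lie. *)
Lemma clash_LR (Z1 Z X Y : {set T}) : #|Z| = #|Z1|.+1 -> below Z1 Z ->
  tri X Z1 -> tri X Z -> #|X| <= #|Z| -> ~~ (X \subset Z1) ->
  tri Z1 Y -> tri Z Y -> #|Z1| <= #|Y| -> ~~ (Z \subset Y) ->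
  X \subset Y -> False.
Proof.
move=> cZ Z1Z XZ1 XZ leX /subsetPn[t tX tZ1] Z1Y ZY leY /subsetPn[z zZ zY] /subsetP sXY.
have subE (x : T) : (x \in X) ==> (x \in Y) by apply/implyP/sXY.
have bXZ : below X Z by move: XZ; rewrite /tri leX.
have bZ1Y : below Z1 Y by move: Z1Y; rewrite /tri leY.
(* The sizes of [Z1] and [Z] are consecutive, so the other branch means |X| = |Z|; similarly |Y| <
   |Z| means |Y| = |Z1|. *)
have [leX1|] := leqP #|X| #|Z1|; last first.
  have [leZY ltX|ltY ltX] := leqP #|Z| #|Y|.
    have bZY : below Z Y by move: ZY; rewrite /tri leZY.
    have zX : z \notin X by have := subE z; chase.
    have [|u] := card_exDx _ zZ zX; first nlia.
    have := belowE u z bXZ; have := belowE z u bZY; have := subE z; have := subE u; chase.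
  have /subset_leq_card := introT subsetP sXY; nlia.
have bXZ1 : below X Z1 by move: XZ1; rewrite /tri leX1.
have [leZY|ltY] := leqP #|Z| #|Y|; last first.
  have tY : t \in Y by have := subE t; chase.
  have [|q] := card_exDx _ tY tZ1; first nlia.
  have := belowE q t bZ1Y; have := belowE t q bXZ1; have := subE t; have := subE q; chase.
have bZY : below Z Y by move: ZY; rewrite /tri leZY.
have zX : z \notin X by have := subE z; chase.
have zZ1 : z \notin Z1.
  have := belowE t z bXZ1; have := belowE z t bZ1Y; have := subE t; chase.
have tZ : t \in Z.
  have := belowE t z bXZ; have := belowE z t bZY; have := subE t; chase.
have tz : t != z by apply: contraNneq zX => <-.
(* Both [t] and [z] lie in [Z] outside [Z1], which is smaller by one only. This yields an [e] in
   [Z1] outside [Z], before both of them; it is unrelated to the minimum of the ground set. The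
   other clashes use the same device. *)
have [e] : exists e, (e \in Z1) && (e \notin Z).
  by apply: (card_exDxx (x := t) (y := z)) => //; nlia.
have := belowE e t Z1Z; have := belowE t e bXZ1; have := belowE e z bXZ.
have := belowE z e bZY; have := subE e; chase.
Qed.

Lemma clash_RL (Z1 Z X Y : {set T}) : #|Z| = #|Z1|.+1 -> below Z1 Z ->
  surr X Z1 -> surr X Z -> #|X| < #|Z1| -> ~~ below Z1 X ->
  surr Z1 Y -> surr Z Y -> #|Z| < #|Y| -> ~~ below Y Z ->
  below Y X -> False.
Proof.
move=> cZ Z1Z XZ1 XZ ltX /belowN[q [t /and5P[qZ1 qX tX tZ1 tq]]].
move=> Z1Y ZY ltY /belowN[s [z /and5P[sY sZ zZ zY zs]]] YX.
(* As [Z] surrounds [Y], the point [z], being before one element of [Y :\: Z], is before all of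
   them. [minX] is the same for [t] and [Z1 :\: X]. *)
have minY u : (u \in Y) && (u \notin Z) ==> (f z < f u).
  by have := surrE u z s ZY; move: zs; have := @f_lt u z Y; chase.
have minX u : (u \in Z1) && (u \notin X) ==> (f t < f u).
  by have := surrE u t q XZ1; move: tq; have := @f_lt u t Z1; chase.
have [w /andP[wY wX]] : exists w, (w \in Y) && (w \notin X).
  by apply: card_exD; nlia.
have ex_e u v : u \in Z -> u \notin Z1 -> v \in Z -> v \notin Z1 -> u != v ->
    exists e, (e \in Z1) && (e \notin Z).
  by move=> *; apply: (card_exDxx (x := u) (y := v)) => //; nlia.
have neq (A : {set T}) u v : u \in A -> v \notin A -> u != v.
  by move=> uA; apply: contraNneq => <-.
have [tY|tY] := boolP (t \in Y); last first.
  have wt : f w < f t by have := belowE w t YX; chase.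
  have wZ1 : w \notin Z1 by move: wt; have := minX w; chase.
  have qY : q \notin Y by move: tq; have := belowE q t YX; chase.
  have [wZ|wZ] := boolP (w \in Z).
    have tZ : t \in Z.
      by move: tq wt; have := surrE w t q XZ; have := belowE q w Z1Z; chase.
    have [e /andP[eZ1 eZ]] := ex_e _ _ wZ wZ1 tZ tZ1 (neq _ _ _ wY tY).
    have := belowE e w Z1Z; have := minX e; have := minY e; have := belowE w e YX.
    by move: tq wt; have := belowE w z YX; have := minX z; have := belowE e z Z1Z; chase.
  have zX : z \notin X by have := minY w; have := belowE w z YX; chase.
  have zZ1 : z \notin Z1 by move: wt; have := minY w; have := minX z; chase.
  have tZ : t \in Z.
    move: wt tq; have := minY w; have := surrE z t q XZ; have := belowE q z Z1Z; chase.
  have [e /andP[eZ1 eZ]] := ex_e _ _ tZ tZ1 zZ zZ1 (neq _ _ _ tX zX).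
  move: wt; have := belowE e z Z1Z; have := minX e; have := minY e.
  by have := minY w; have := belowE w e YX; chase.
have [tZ|tZ] := boolP (t \in Z); last first.
  have [zX|zX] := boolP (z \in X).
    move: tq; have := surrE w t q XZ; have := minX w; have := belowE q w Z1Z.
    by have := belowE w z YX; have := minY w; have := minY t; chase.
  move: tq; have := surrE z t q XZ; have := minX z; have := belowE q z Z1Z.
  by have := minY t; chase.
have qZ : q \in Z by move: tq; have := belowE q t Z1Z; chase.
have zt := neq _ _ _ tY zY.
have [zX|zX] := boolP (z \in X).
  have wz : f w < f z by have := belowE w z YX; chase.
  have wZ : w \in Z by move: wz; have := minY w; chase.
  have sX : s \in X by move: zs; have := belowE s z YX; chase.
  have [zZ1|zZ1] := boolP (z \in Z1); last first.
    have [e /andP[eZ1 eZ]] := ex_e _ _ tZ tZ1 zZ zZ1 zt.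
    have := belowE e t Z1Z; have := belowE e z Z1Z; have := minX e; have := minY e.
    by have := belowE w e YX; have := minX w; have := belowE e w Z1Z; chase.
  have [sZ1|sZ1] := boolP (s \in Z1).
    move: wz zs; have := belowE s t Z1Z; have := minX w; have := belowE s w Z1Z; chase.
  have ltzt : f z < f t.
    by move: zs; have := surrE t z s Z1Y; chase.
  have wZ1 : w \notin Z1 by move: wz ltzt; have := minX w; chase.
  have [e /andP[eZ1 eZ]] := ex_e _ _ tZ tZ1 wZ wZ1 (neq _ _ _ tX wX).
  have := belowE e w Z1Z; have := belowE e t Z1Z; have := minX e; have := minY e.
  by move: wz; have := belowE w e YX; chase.
have [zZ1|zZ1] := boolP (z \in Z1).
  move: zs; have := minX z; have := surrE t z s Z1Y; have := belowE s t Z1Z; chase.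
have [e /andP[eZ1 eZ]] := ex_e _ _ tZ tZ1 zZ zZ1 zt.
have eX : e \in X by have := minX e; have := belowE e t Z1Z; chase.
have eY : e \notin Y by have := minY e; have := belowE e z Z1Z; chase.
have sX : s \in X.
  by move: zs; have := belowE s e YX; have := belowE e z Z1Z; chase.
have qs : f q < f s by move: zs; have := surrE z s q XZ; chase.
move: tq qs; have := belowE q e YX; have := belowE e t Z1Z.
by have := surrE t q s Z1Y; have := belowE s t Z1Z; chase.
Qed.

Lemma clash_LL (Z1 Z X Y : {set T}) : #|Z| = #|Z1|.+1 -> below Z1 Z ->
  tri X Z1 -> below X Z -> #|X| <= #|Z| -> ~~ (X \subset Z1) ->
  surr Z1 Y -> surr Z Y -> #|Z| < #|Y| -> ~~ below Y Z ->
  below Y X -> False.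
Proof.
move=> cZ Z1Z XZ1 XZ leX /subsetPn[t tX tZ1].
move=> Z1Y ZY ltY /belowN[s [z /and5P[sY sZ zZ zY zs]]] YX.
have minY u : (u \in Y) && (u \notin Z) ==> (f z < f u).
  by have := surrE u z s ZY; move: zs; have := @f_lt u z Y; chase.
have [zX|zX] := boolP (z \in X).
  have [|w /andP[wY wX]] := @card_exD _ X Y; first nlia.
  move: zs; have := belowE s z YX; have := belowE w z YX; have := minY w.
  by have := belowE s w XZ; chase.
have subE u : (u \in X) ==> (u \in Z).
  move: zs; have := belowE u z XZ; have := minY u; have := belowE s u YX.
  by have := belowE s z XZ; chase.
have leX1 : #|X| <= #|Z1|.
  have /subset_leq_card : X \subset Z :\ z.
    apply/subsetP => u uX; rewrite !inE (implyP (subE u) uX) andbT.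
    by apply: contraNneq zX => <-.
  by rewrite [#|Z|](cardsD1 z) zZ in cZ; move: cZ; clear; lia.
have bXZ1 : below X Z1 by move: XZ1; rewrite /tri leX1.
have tZ : t \in Z by have := subE t; chase.
have [zZ1|zZ1] := boolP (z \in Z1).
  move: zs; have := belowE t z bXZ1; have := belowE s t YX.
  by have := surrE t z s Z1Y; have := belowE s t Z1Z; have := subE s; chase.
have [e /andP[eZ1 eZ]] : exists e, (e \in Z1) && (e \notin Z).
  apply: (card_exDxx (x := z) (y := t)) => //; first nlia.
  by apply: contraNneq zX => ->.
by have := belowE e t Z1Z; have := belowE t e bXZ1; have := subE e; chase.
Qed.

Lemma clash_RR (Z1 Z X Y : {set T}) : #|Z| = #|Z1|.+1 -> below Z1 Z ->
  surr X Z1 -> surr X Z -> #|X| < #|Z1| -> ~~ below Z1 X ->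
  below Z1 Y -> tri Z Y -> #|Z1| <= #|Y| -> ~~ (Z \subset Y) ->
  below Y X -> False.
Proof.
move=> cZ Z1Z XZ1 XZ ltX /belowN[q [t /and5P[qZ1 qX tX tZ1 tq]]].
move=> Z1Y ZY leY /subsetPn[z zZ zY] YX.
have minX u : (u \in Z1) && (u \notin X) ==> (f t < f u).
  by have := surrE u t q XZ1; move: tq; have := @f_lt u t Z1; chase.
have [tY|tY] := boolP (t \in Y); last first.
  have [|w /andP[wY wX]] := @card_exD _ X Y; first nlia.
  move: tq; have := belowE w t YX; have := minX w; have := belowE q t YX.
  by have := belowE q w Z1Y; chase.
have qY : q \in Y by move: tq; have := belowE q t Z1Y; chase.
have subE u : (u \in Z1) ==> (u \in Y).
  by move: tq; have := belowE u t Z1Y; have := minX u; have := belowE q u YX; chase.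
have leZY : #|Z| <= #|Y|.
  rewrite leqNgt; apply/negP => ltY.
  have [|e /andP[eZ1 eY]] := card_exDx _ tY tZ1; first nlia.
  by have := subE e; chase.
have bZY : below Z Y by move: ZY; rewrite /tri leZY.
have zZ1 : z \notin Z1 by have := subE z; chase.
have [tZ|tZ] := boolP (t \in Z); last first.
  move: tq; have := belowE z t bZY; have := belowE q z YX.
  by have := surrE z t q XZ; have := belowE q z Z1Z; chase.
have [e /andP[eZ1 eZ]] : exists e, (e \in Z1) && (e \notin Z).
  apply: (card_exDxx (x := z) (y := t)) => //; first nlia.
  by apply: contraNneq zY => ->.
by have := subE e; have := belowE z e bZY; have := belowE e z Z1Z; chase.
Qed.

Lemma belowP A B :
  reflect (forall x y, x \in A -> x \notin B -> y \in B -> y \notin A -> f x < f y)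
    (below A B).
Proof.
apply: (iffP idP) => [bAB x y xA xB yB yA|bAB]; first by have := belowE x y bAB; chase.
apply/negPn/negP => /belowN[x [y /and5P[xA xB yB yA yx]]].
by have := bAB x y xA xB yB yA; move: yx; clear; lia.
Qed.

Lemma surrP A B :
  reflect (forall b a b', a \in A -> a \notin B -> b \in B -> b \notin A ->
             b' \in B -> b' \notin A -> (f a < f b) || (f b' < f a))
    (surr A B).
Proof.
apply: (iffP idP) => [sAB b a b' aA aB bB bA b'B b'A|sAB].
  by have := surrE b a b' sAB; chase.
apply/negPn/negP => /surrN[b [a [b' /and5P[aA aB bB bA /and3P[b'B b'A lt]]]]].
by have := sAB b a b' aA aB bB bA b'B b'A; move: lt; clear; lia.
Qed.

Lemma wslC X Y : wsl X Y = wsl Y X.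
Proof. by rewrite /wsl orbC. Qed.

Lemma wsl_ltcard X Y : #|X| < #|Y| -> wsl X Y = surr X Y.
Proof. by move=> lt; rewrite /wsl (ltnW lt) leqNgt lt orbF. Qed.

Definition lt_all e X := forall x, x \in X -> f e < f x.

Lemma lt_all_notin e X : lt_all e X -> e \notin X.
Proof. by move=> eX; apply/negP => /eX; rewrite ltnn. Qed.

(** * Effect of the minimum of the ground set on the relations *)

Section Minimum.
Variable e : T.

Lemma setDUU X Y : e \notin X -> (e |: X) :\: (e |: Y) = X :\: Y.
Proof.
move=> eX; apply/setP => x; rewrite !inE; have [->|//] := eqVneq x e.
by rewrite (negbTE eX) andbF.
Qed.

Variables X Y : {set T}.
Hypotheses (eX : lt_all e X) (eY : lt_all e Y).
Let eX' := lt_all_notin eX.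
Let eY' := lt_all_notin eY.

Lemma belowUU : below (e |: X) (e |: Y) = below X Y.
Proof. by rewrite /below !setDUU. Qed.

Lemma neq_min x Z : e \notin Z -> x \in Z -> (x == e) = false.
Proof. by move=> eZ xZ; apply: contraNF eZ => /eqP <-. Qed.

Lemma belowUl : below (e |: X) Y = below X Y.
Proof.
apply/belowP/belowP => bXY x y.
  move=> xX xY yY yX; apply: bXY => //; rewrite !inE ?xX ?orbT //.
  by rewrite (neq_min eY' yY).
rewrite !inE => /predU1P[->|xX] xY yY; first by move=> _; apply: eY.
by rewrite (neq_min eY' yY) => yX; apply: bXY.
Qed.

(** An element of [X] outside [Y] would have to precede [e], which is before all of [X]. *)
Lemma belowUr : below X (e |: Y) = (X \subset Y).
Proof.
apply/belowP/subsetP => [bXY x xX|sXY x y /sXY xY]; last by rewrite !inE xY orbT.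
apply/negPn/negP => xY; have := bXY x e xX.
rewrite !inE (neq_min eX' xX) xY eqxx eX' => /(_ isT isT isT).
by have := eX xX; clear; lia.
Qed.

Lemma surrUl : surr (e |: X) Y = surr X Y.
Proof.
apply/surrP/surrP => sXY b a b'.
  move=> aX aY bY bX b'Y b'X; apply: sXY => //; rewrite !inE ?aX ?orbT //.
    by rewrite (neq_min eY' bY).
  by rewrite (neq_min eY' b'Y).
rewrite !inE => /predU1P[->|aX] aY bY.
  by move=> _ b'Y _; rewrite (eY bY).
rewrite (neq_min eY' bY) => bX b'Y; rewrite (neq_min eY' b'Y) => b'X.
exact: sXY.
Qed.

(** Every element of [X :\: Y] has [e] on its left, so it can only avoid being enclosed by lying
    after all of [Y :\: X]. *)
Lemma surrUr : surr X (e |: Y) = below Y X.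
Proof.
apply/surrP/belowP => [sXY y x yY yX xX xY|bYX b a b'].
  have := sXY e x y xX.
  rewrite !inE (neq_min eX' xX) eqxx yY yX eX' xY orbT => /(_ isT isT isT isT isT).
  by have := eX xX; clear; lia.
rewrite !inE => aX; rewrite (neq_min eX' aX) => aY _ _.
move=> /predU1P[-> _|b'Y b'X]; first by rewrite (eX aX) orbT.
by rewrite (bYX b' a) ?orbT.
Qed.

Lemma triUU : tri (e |: X) (e |: Y) = tri X Y.
Proof. by rewrite /tri belowUU /surr !setDUU // !cardsU1 eX' eY'. Qed.

Lemma wslUU : wsl (e |: X) (e |: Y) = wsl X Y.
Proof. by rewrite /wsl /surr !setDUU // !cardsU1 eX' eY'. Qed.

End Minimum.

(** A minimum on the first side makes the two branches of [tri] agree, so the sizes no longer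
    matter. *)
Lemma triUl e X Y : lt_all e X -> lt_all e Y -> tri (e |: X) Y = below X Y.
Proof. by move=> eX eY; rewrite /tri belowUl // surrUr // if_same. Qed.

Lemma triUr e X Y : lt_all e X -> lt_all e Y ->
  tri X (e |: Y) = if #|X| <= #|Y|.+1 then X \subset Y else surr Y X.
Proof.
by move=> eX eY; rewrite /tri belowUr // surrUl // cardsU1 lt_all_notin.
Qed.

Lemma wslUr e X Y : lt_all e X -> lt_all e Y ->
  wsl X (e |: Y) = if #|X| <= #|Y| then below Y X else surr Y X.
Proof.
move=> eX eY; rewrite /wsl surrUr // surrUl // cardsU1 lt_all_notin // add1n.
case: (ltngtP #|X| #|Y|) => [lt|lt|eq].
- by rewrite leqW ?(ltnW lt) //= orbF.
- by rewrite /= orb_idl // => /andP[_]; exact: below_surr.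
- by rewrite eq leqnSn orbF.
Qed.

Lemma sub_below X Y : X \subset Y -> below X Y.
Proof. by move=> /subsetP sXY; apply/belowP => x y /sXY ->. Qed.

Lemma sub_surr X Y : X \subset Y -> surr X Y.
Proof. by move=> sXY; apply/below_surr/sub_below. Qed.

Lemma setD1_cases e X :
  e \in X /\ X = e |: (X :\ e) \/ e \notin X /\ X = X :\ e.
Proof.
have [eX|eX] := boolP (e \in X); [left|right]; split=> //; first by rewrite setD1K.
apply/setP => x; rewrite !inE; case: eqVneq => // ->; exact: negbTE.
Qed.

Lemma tri_del e X Y : lt_all e (X :\ e) -> lt_all e (Y :\ e) ->
  tri X Y -> tri (X :\ e) (Y :\ e).
Proof.
case: (setD1_cases e X) => [[_ defX]|[_ <-]];
  case: (setD1_cases e Y) => [[_ defY]|[_ <-]] eX eY //.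
- by rewrite {1}defX {1}defY triUU.
- rewrite {1}defX triUl // /tri => bXY; case: ifP => _ //; exact: below_surrC.
- rewrite {1}defY triUr // /tri; case: (leqP #|X| (#|Y :\ e|).+1) => [_ sXY | lt].
    by rewrite (subset_leq_card sXY); apply: sub_below.
  by rewrite leqNgt (ltnW lt).
Qed.

Lemma wsl_del e X Y : lt_all e (X :\ e) -> lt_all e (Y :\ e) ->
  wsl X Y -> wsl (X :\ e) (Y :\ e).
Proof.
have wsl1 A B : lt_all e A -> lt_all e B -> wsl A (e |: B) -> wsl A B.
  move=> eA eB; rewrite wslUr // /wsl; case: (leqP #|A| #|B|) => [_ bBA|lt ->].
    by rewrite below_surrC.
  by rewrite (ltnW lt).
case: (setD1_cases e X) => [[_ defX]|[_ <-]];
  case: (setD1_cases e Y) => [[_ defY]|[_ <-]] eX eY //.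
- by rewrite {1}defX {1}defY wslUU.
- by rewrite {1}defX wslC [wsl _ Y]wslC; apply: wsl1.
- by rewrite {1}defY; apply: wsl1.
Qed.

(* What a [wsl] family becomes when the maximum of the ground set is deleted: [L]
   comes from the members avoiding it and [R] from those containing it. *)
Definition cut (G : {set T}) (L R : {set {set T}}) : Prop :=
  [/\ forall X, X \in L :|: R -> X \subset G,
      {in L &, forall X Y, wsl X Y}, {in R &, forall X Y, wsl X Y} &
      {in L & R, forall X Y, tri X Y}].

Definition del e (L : {set {set T}}) := [set X :\ e | X in L].

Lemma cut_del G L R e : (forall x, x \in G :\ e -> f e < f x) ->
  cut G L R -> cut (G :\ e) (del e L) (del e R).
Proof.
move=> eG [sG wL wR tLR].
have eD X : X \in L :|: R -> lt_all e (X :\ e).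
  by move=> /sG sX x /(subsetP (setSD _ sX)); apply: eG.
have eL X : X \in L -> lt_all e (X :\ e) by move=> XL; apply: eD; rewrite inE XL.
have eR X : X \in R -> lt_all e (X :\ e) by move=> XR; apply: eD; rewrite inE XR orbT.
split.
- by move=> _ /setUP[] /imsetP[X XLR ->]; rewrite setSD // sG // inE XLR ?orbT.
- by move=> _ _ /imsetP[X XL ->] /imsetP[Y YL ->]; apply: wsl_del; auto.
- by move=> _ _ /imsetP[X XL ->] /imsetP[Y YL ->]; apply: wsl_del; auto.
- by move=> _ _ /imsetP[X XL ->] /imsetP[Y YL ->]; apply: tri_del; auto.
Qed.

Definition between (L R : {set {set T}}) Z : bool :=
  [forall X in L, tri X Z] && [forall Y in R, tri Z Y].

Lemma betweenP (L R : {set {set T}}) Z :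
  reflect ((forall X, X \in L -> tri X Z) /\ (forall Y, Y \in R -> tri Z Y))
          (between L R Z).
Proof. by apply: (iffP andP) => -[/forall_inP ? /forall_inP ?]. Qed.

Lemma betweenN (L R : {set {set T}}) Z : ~~ between L R Z ->
  (exists2 X, X \in L & ~~ tri X Z) \/ (exists2 Y, Y \in R & ~~ tri Z Y).
Proof.
rewrite negb_and => /orP[] /forall_inPn[X XL nX]; [left|right]; by exists X.
Qed.

(** Enlarging the cut makes a later set between its sides comparable with [Z] as well; this is how
    two sets of consecutive sizes are obtained one below the other. *)
Lemma cutU1 G L R Z : Z \subset G -> cut G L R -> between L R Z ->
  cut G (Z |: L) (Z |: R).
Proof.
move=> sZ [sG wL wR tLR] /betweenP[LZ ZR].
have tZZ : tri Z Z by rewrite /tri leqnn sub_below.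
split.
- move=> X; rewrite !inE -orbA => /or4P[/eqP-> //|XL|/eqP-> //|XR]; apply: sG.
    by rewrite inE XL.
  by rewrite inE XR orbT.
- move=> X Y /setU1P[->|XL] /setU1P[->|YL]; [exact: tri_wsl| | |exact: wL].
    by rewrite wslC; apply/tri_wsl/LZ.
  exact/tri_wsl/LZ.
- move=> X Y /setU1P[->|XL] /setU1P[->|YL]; [exact: tri_wsl| | |exact: wR].
    exact/tri_wsl/ZR.
  by rewrite wslC; apply/tri_wsl/ZR.
- move=> X Y /setU1P[->|XL] /setU1P[->|YL] //; [exact: ZR|exact: LZ|exact: tLR].
Qed.

(** After deletion of the minimum [e], the induction gives [Z1] of size k - 1, and then, for the cut
    enlarged by [Z1], a [Z] of size k with [below Z1 Z]. Either [Z] or [e |: Z1] works in [G], since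
    an obstruction to each would produce a clash. *)
Lemma ex_between G L R k : cut G L R -> k <= #|G| ->
  exists2 Z : {set T}, Z \subset G & #|Z| = k /\ between L R Z.
Proof.
move eqc: #|G| => c; elim: c => [|c IHc] in G L R k eqc *.
  move=> [sG _ _ _]; rewrite leqn0 => /eqP->; exists set0; first exact: sub0set.
  rewrite cards0; split=> //; apply/betweenP.
  have X0 X : X \in L :|: R -> X = set0.
    by move=> /sG; rewrite (cards0_eq eqc) subset0 => /eqP.
  by split=> X XL; rewrite (X0 X) ?inE ?XL ?orbT // /tri leqnn sub_below.
move=> cLR lekc; have [sG wL wR tLR] := cLR.
have [->|kgt0] := posnP k.
  exists set0; first exact: sub0set.
  rewrite cards0; split=> //; apply/betweenP; split=> X _; rewrite /tri cards0.
    case: ifP => [|_]; last by rewrite sub_surr // sub0set.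
    by rewrite leqn0 cards_eq0 => /eqP->; apply: sub_below.
  by rewrite leq0n sub_below // sub0set.
move: lekc; rewrite leq_eqVlt => /predU1P[->|ltkc].
  exists G => //; split=> //; apply/betweenP; split=> X XLR.
    have sX : X \subset G by rewrite sG // inE XLR.
    by rewrite /tri subset_leq_card // sub_below.
  have sX : X \subset G by rewrite sG // inE XLR orbT.
  rewrite /tri; case: ifP => [leGX|_]; last exact: sub_surr.
  by have/eqP-> : X == G; rewrite ?sub_below // eqEcard sX.
have [e0 e0G] : exists e0, e0 \in G by apply/set0Pn; rewrite -card_gt0 eqc.
pose e := [arg min_(x < e0 in G) f x].
have [eG minG] : e \in G /\ forall x, x \in G -> f e <= f x.
  by rewrite /e; case: arg_minnP => // x xG ?.
have ltG x : x \in G :\ e -> f e < f x.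
  rewrite !inE => /andP[xe /minG]; rewrite leq_eqVlt => /predU1P[/f_inj ex|//].
  by rewrite ex eqxx in xe.
have cG' : #|G :\ e| = c by move: eqc; rewrite (cardsD1 e) eG => -[].
have cut' := cut_del ltG cLR.
have [|Z1 sZ1 [cZ1 bZ1]] := IHc _ _ _ k.-1 cG' cut'; first by move: ltkc; clear; lia.
have [|Z sZ [cZ /betweenP[LZ ZR]]] := IHc _ _ _ k cG' (cutU1 sZ1 cut' bZ1).
  by move: ltkc; clear; lia.
have {bZ1} /betweenP[LZ1 Z1R] := bZ1.
have eZ1 : lt_all e Z1 by move=> x /(subsetP sZ1)/ltG.
have eZ : lt_all e Z by move=> x /(subsetP sZ)/ltG.
have cZZ1 : #|Z| = #|Z1|.+1 by rewrite cZ cZ1 prednK.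
have Z1Z : below Z1 Z.
  by have := LZ Z1 (setU11 _ _); rewrite /tri cZZ1 leqnSn.
have [bZ|nZ] := boolP (between L R Z).
  by exists Z => //; apply: subset_trans sZ (subD1set _ _).
exists (e |: Z1).
  by rewrite subUset sub1set eG (subset_trans sZ1 (subD1set _ _)).
rewrite cardsU1 lt_all_notin // add1n -cZZ1; split=> //.
apply/negPn/negP => /betweenN nZ1; have {nZ} := betweenN nZ.
have dL X : X \in L -> [/\ lt_all e (X :\ e), tri (X :\ e) Z1 & tri (X :\ e) Z].
  move=> XL; split; [|by apply: LZ1; apply: imset_f|by apply/LZ/setU1r/imset_f].
  move=> x xX; apply: ltG; apply: subsetP xX; apply/setSD/sG; by rewrite inE XL.
have dR X : X \in R -> [/\ lt_all e (X :\ e), tri Z1 (X :\ e) & tri Z (X :\ e)].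
  move=> XR; split; [|by apply: Z1R; apply: imset_f|by apply/ZR/setU1r/imset_f].
  move=> x xX; apply: ltG; apply: subsetP xX; apply/setSD/sG; by rewrite inE XR orbT.
(* If [X] contains [e], comparing it with [e |: Z1] amounts to comparing the sets without [e]. Hence
   only members without [e] obstruct [e |: Z1], and only members with [e] obstruct [Z]. *)
have blockZ1L X : X \in L -> ~~ tri X (e |: Z1) ->
    [/\ lt_all e X, tri X Z1, below X Z, #|X| <= #|Z| & ~~ (X \subset Z1)].
  move=> /[dup] XL /dL[]; case: (setD1_cases e X) => [[_ defX]|[_ <-]] eX tX1 tX.
    by rewrite {1}defX triUU // tX1.
  rewrite triUr //; case: ifP => [le nX|gt]; last first.
    by move: tX1; rewrite /tri; case: ifP => [le1|_ -> //]; rewrite leqW in gt.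
  by move: tX; rewrite /tri cZZ1 le.
have blockZ1R X : X \in R -> ~~ tri (e |: Z1) X ->
    [/\ lt_all e X, surr X Z1, surr X Z, #|X| < #|Z1| & ~~ below Z1 X].
  move=> /[dup] XR /dR[]; case: (setD1_cases e X) => [[_ defX]|[_ <-]] eX tX1 tX.
    by rewrite {1}defX triUU // tX1.
  rewrite triUl // => nX; move: tX1 tX; rewrite /tri (negbTE nX).
  case: (leqP #|Z1| #|X|) => // lt sX.
  by rewrite leqNgt cZZ1 (ltn_trans lt (ltnSn _)).
have blockZL X : X \in L -> ~~ tri X Z -> exists S,
    [/\ X = e |: S, lt_all e S, surr Z1 S, surr Z S & (#|Z| < #|S|) && ~~ below S Z].
  move=> /[dup] XL /dL[]; case: (setD1_cases e X) => [[_ defX]|[_ <-]] eX tX1 tX.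
    rewrite {1}defX triUl // => nX; exists (X :\ e); rewrite nX.
    move: tX1 tX; rewrite /tri (negbTE nX); case: (leqP _ #|Z|) => // lt.
    by rewrite leqNgt (ltn_trans _ lt) ?cZZ1.
  by rewrite tX.
have blockZR X : X \in R -> ~~ tri Z X -> exists S,
    [/\ X = e |: S, lt_all e S, below Z1 S, tri Z S & (#|Z1| <= #|S|) && ~~ (Z \subset S)].
  move=> /[dup] XR /dR[]; case: (setD1_cases e X) => [[_ defX]|[_ <-]] eX tX1 tX.
    rewrite {1}defX triUr // => nX; exists (X :\ e).
    move: nX tX1 (tX); rewrite {1 2}/tri; case: ifP => [|nle /negbTE->].
      by rewrite cZZ1 ltnS => -> ->.
    by case: ifP => // _ _; case: ifP => // /leqW; rewrite nle.
  by rewrite tX.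
(* The contradiction comes from the relation that the cut imposes between the two obstructing
   members themselves. *)
case: nZ1 => -[X XLR nX] [] [Y YLR nY].
- have [eX tX1 bX leX sX] := blockZ1L _ XLR nX.
  have [S [defY eS sS1 sS /andP[ltS bS]]] := blockZL _ YLR nY.
  apply: (clash_LL cZZ1 Z1Z tX1 bX leX sX sS1 sS ltS bS).
  by have := wL _ _ XLR YLR; rewrite defY wslUr // (leq_trans leX (ltnW ltS)).
- have [eX tX1 bX leX sX] := blockZ1L _ XLR nX.
  have [S [defY eS sS1 sS /andP[ltS bS]]] := blockZR _ YLR nY.
  apply: (clash_LR cZZ1 Z1Z tX1 _ leX sX _ sS ltS bS).
  + by rewrite /tri leX.
  + by rewrite /tri ltS.
  by have := tLR _ _ XLR YLR; rewrite defY triUr // (leq_trans leX) // cZZ1.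
- have [eX tX1 tX ltX bX] := blockZ1R _ XLR nX.
  have [S [defY eS sS1 sS /andP[ltS bS]]] := blockZL _ YLR nY.
  apply: (clash_RL cZZ1 Z1Z tX1 tX ltX bX sS1 sS ltS bS).
  by have := tLR _ _ YLR XLR; rewrite defY triUl.
- have [eX tX1 tX ltX bX] := blockZ1R _ XLR nX.
  have [S [defY eS sS1 sS /andP[ltS bS]]] := blockZR _ YLR nY.
  apply: (clash_RR cZZ1 Z1Z tX1 tX ltX bX sS1 sS ltS bS).
  by have := wR _ _ XLR YLR; rewrite defY wslUr // (leq_trans (ltnW ltX) ltS).
Qed.

(** * Neighbours of a set lying between the sides of a cut *)

Lemma sup_below X Y : X \subset Y -> below Y X.
Proof. by move=> /subsetP sXY; apply/belowP => x y _ _ /sXY ->. Qed.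

(** If [b |: X] surrounds [S], then [b] cannot separate [u] from [s]. If [S] surrounds [b |: X], the
    sizes are equal, and [u] before [b] would give a [v] in [X :\: S]; it lies after [s], so [s]
    would be enclosed by [b] and [v]. *)
Lemma add1_min X S b s : b \notin X -> below S X -> s \in S -> s \notin X ->
  b \notin S -> f b < f s -> wsl S (b |: X) -> #|X| < #|S| ->
  forall u, u \in S -> u \notin X -> f b < f u.
Proof.
move=> bX SX sS sX bS bs wS leS u uS uX.
have cXb : #|b |: X| = #|X|.+1 by rewrite cardsU1 bX.
have inXb v : (v \in b |: X) = (v == b) || (v \in X) by rewrite !inE.
have sb : (s == b) = false by apply: contraNF bS => /eqP <-.
have ub : (u == b) = false by apply: contraNF bS => /eqP <-.
have [sXb|[sSb cS]] : surr (b |: X) S \/ (surr S (b |: X) /\ #|S| = #|X|.+1).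
  by move: wS; rewrite /wsl cXb; case/orP => /andP[le ->]; [right|left]; split=> //; nlia.
  have := surrE u b s sXb; have := @f_lt u b S.
  by move: bs; rewrite !inXb eqxx ub sb; chase.
rewrite ltnNge; apply/negP => leub.
have [v /andP[vX vS]] : exists v, (v \in X) && (v \notin S).
  apply: (card_exDxx (x := u) (y := s)) => //; first nlia.
  by apply: contraTneq bs => <-; rewrite -leqNgt.
have := surrE b s v sSb; have := belowE s v SX.
by move: bs; rewrite !inXb eqxx sb; case: (v == b); chase.
Qed.

(* In [ex_add1], where [e] is the minimum of the ground set, a member [Y] of the
   cut prevents adding [e] to [X] and a member [e |: S] prevents adding [b].  The
   letters tell the sides of the cut on which [Y] and [e |: S] lie. *)
Lemma add1_clash_LL X Y S b : b \notin X ->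
  #|Y| <= #|X| -> below Y X -> ~~ below X Y -> wsl Y (b |: X) ->
  #|X| < #|S| -> below S X -> ~~ below S (b |: X) -> wsl S (b |: X) ->
  below S Y -> False.
Proof.
move=> bX leY YX /belowN[x [t /and5P[xX xY tY tX tx]]] wY leS SX.
have cXb : #|b |: X| = #|X|.+1 by rewrite cardsU1 bX.
have {wY} sY : surr Y (b |: X) by rewrite wsl_ltcard // cXb in wY.
move=> /belowN[s [p /and5P[sS]]]; rewrite !inE negb_or => /andP[sb sX] pXb pS ps wS SY.
have bS : (b \notin S) && (f b < f s).
  by case/predU1P: pXb ps pS => [-> -> -> // | pX]; have := belowE s p SX; chase.
case/andP: bS => bS bs.
have inXb u : (u \in b |: X) = (u == b) || (u \in X) by rewrite !inE.
have neqb u A : u \in A -> b \notin A -> (u == b) = false.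
  by move=> uA; apply: contraNF => /eqP <-.
have minS := add1_min bX SX sS sX bS bs wS leS.
have [bY|bY] := boolP (b \in Y).
  have [|w /andP[wiS wY]] := @card_exD _ Y S; first nlia.
  have := minS w wiS; have := belowE w b SY; have := belowE s b SY.
  by have := belowE s w YX; move: bs; chase.
have tb : (t == b) = false := neqb _ _ tY bY.
have := surrE b t x sY; have := surrE b s x sY; have := belowE s t SY.
have := belowE s x YX; have := minS t; have := @f_lt t b Y; move: tx bs.
by rewrite !inXb eqxx tb (negbTE sb) xX orbT; chase.
Qed.

Lemma add1_clash_LR X Y S b : b \notin X ->
  below Y X -> ~~ below X Y -> surr Y (b |: X) ->
  X \subset S -> b \notin S -> tri (b |: X) S -> Y \subset S -> False.
Proof.
move=> bX YX /belowN[x [t /and5P[xX xY tY tX tx]]] sY sXS bS tS /subsetP sYS.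
have tS' := sYS t tY; have bY : b \notin Y by apply: contra bS; apply: sYS.
have inXb u : (u \in b |: X) = (u == b) || (u \in X) by rewrite !inE.
have tb : (t == b) = false by apply: contraNF bS => /eqP <-.
have bXS : below (b |: X) S.
  move: tS; rewrite /tri cardsU1 bX add1n; case: ltnP => // leSX.
  have /eqP eXS : X == S by rewrite eqEcard sXS.
  by rewrite eXS tS' in tX.
have := belowE b t bXS; have := surrE b t x sY; move: tx.
by rewrite !inXb eqxx tb xX orbT; chase.
Qed.

Lemma add1_clash_RL X Y S b : b \notin X ->
  #|Y| < #|X| -> surr Y X -> ~~ below X Y -> surr Y (b |: X) ->
  #|X| < #|S| -> below S X -> ~~ below S (b |: X) -> wsl S (b |: X) ->
  below S Y -> False.
Proof.
move=> bX ltY sYX /belowN[x [t /and5P[xX xY tY tX tx]]] sY leS SX.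
have cXb : #|b |: X| = #|X|.+1 by rewrite cardsU1 bX.
move=> /belowN[s [p /and5P[sS]]]; rewrite !inE negb_or => /andP[sb sX] pXb pS ps wS SY.
have bS : (b \notin S) && (f b < f s).
  by case/predU1P: pXb ps pS => [-> -> -> // | pX]; have := belowE s p SX; chase.
case/andP: bS => bS bs.
have inXb u : (u \in b |: X) = (u == b) || (u \in X) by rewrite !inE.
have neqb u A : u \in A -> b \notin A -> (u == b) = false.
  by move=> uA; apply: contraNF => /eqP <-.
have minS := add1_min bX SX sS sX bS bs wS leS.
have [|w /andP[wiS wY]] := @card_exD _ Y S; first nlia.
have minw := minS w wiS; have mint := minS t.
have [bY|bY] := boolP (b \in Y).
  have := belowE w b SY; have := belowE s b SY; have := surrE w s x sYX.
  have := belowE w t SY; have := surrE w t x sYX; move: minw mint bs tx; chase.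
have tb : (t == b) = false := neqb _ _ tY bY.
have := surrE b t x sY; have := belowE w t SY; have := surrE w t x sYX.
move: minw mint tx bs; rewrite !inXb eqxx tb xX orbT; chase.
Qed.

Lemma add1_clash_RR X Y S b : b \notin X ->
  surr Y X -> ~~ below X Y -> surr Y (b |: X) ->
  X \subset S -> b \notin S -> tri (b |: X) S -> below S Y -> False.
Proof.
move=> bX sYX /belowN[x [t /and5P[xX xY tY tX tx]]] sY /[dup] sXS /subsetP XS bS tS SY.
have xS := XS x xX.
have tS' : t \in S by move: tx; have := belowE x t SY; chase.
have inXb u : (u \in b |: X) = (u == b) || (u \in X) by rewrite !inE.
have tb : (t == b) = false by apply: contraNF bS => /eqP <-.
have bXS : below (b |: X) S.
  move: tS; rewrite /tri cardsU1 bX add1n; case: ltnP => // leSX.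
  have /eqP eXS : X == S by rewrite eqEcard sXS.
  by rewrite eXS tS' in tX.
have := belowE b t bXS; have := belowE x b SY; have := surrE b t x sY; move: tx.
by rewrite !inXb eqxx tb xX orbT; chase.
Qed.

(** The conclusion is what puts [b |: X] into [L] when the family is maximal. With [e] the minimum:
    if [e] is in [X], the [b] of the smaller ground set works; otherwise [e] itself is tried, and if
    it is obstructed, that [b] works, as two obstructions clash. *)
Lemma ex_add1 G L R X : cut G L R -> X \proper G -> between L R X ->
  exists2 b, b \in G & [/\ b \notin X, forall Y, Y \in L -> wsl Y (b |: X) &
                           forall Y, Y \in R -> tri (b |: X) Y].
Proof.
move eqc: #|G| => c; elim: c => [|c IHc] in G L R X eqc *.
  by move=> _ /proper_card; rewrite eqc.
move=> cLR pX /betweenP[LX XR]; have [sG wL wR tLR] := cLR.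
have [e0 e0G] : exists e0, e0 \in G by apply/set0Pn; rewrite -card_gt0 eqc.
pose e := [arg min_(x < e0 in G) f x].
have [eG minG] : e \in G /\ forall x, x \in G -> f e <= f x.
  by rewrite /e; case: arg_minnP => // x xG ?.
have ltG x : x \in G :\ e -> f e < f x.
  rewrite !inE => /andP[xe /minG]; rewrite leq_eqVlt => /predU1P[/f_inj ex|//].
  by rewrite ex eqxx in xe.
have cG' : #|G :\ e| = c by move: eqc; rewrite (cardsD1 e) eG => -[].
have cut' := cut_del ltG cLR.
have sXG := proper_sub pX.
have eD Y : Y \subset G -> lt_all e (Y :\ e).
  by move=> sY x xY; apply: ltG; apply: subsetP xY; apply: setSD.
have eL Y : Y \in L -> lt_all e (Y :\ e) by move=> YL; apply/eD/sG; rewrite inE YL.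
have eR Y : Y \in R -> lt_all e (Y :\ e) by move=> YR; apply/eD/sG; rewrite inE YR orbT.
have bX' : between (del e L) (del e R) (X :\ e).
  apply/betweenP; split=> _ /imsetP[Y YLR ->]; apply: tri_del; auto.
have [eX|eX] := boolP (e \in X).
  have pX' : X :\ e \proper G :\ e.
    rewrite properEcard setSD //=; have := proper_card pX.
    by rewrite (cardsD1 e X) (cardsD1 e G) eX eG.
  have defX : e |: X :\ e = X by rewrite setD1K.
  move: pX' bX' defX (eD _ sXG); move: (X :\ e) => X1 pX1 bX1 defX eX1.
  have [b bG [bX1' bL bR]] := IHc _ _ _ _ cG' cut' pX1 bX1.
  have [be bG'] := setD1P bG.
  have eXb : lt_all e (b |: X1) by move=> x /setU1P[->|/eX1 //]; apply: ltG.
  have cXb : #|b |: X1| = #|X1|.+1 by rewrite cardsU1 bX1'.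
  exists b => //; rewrite -defX setUCA; split.
  - by rewrite !inE negb_or be bX1'.
  - move=> Y YL; have := bL _ (imset_f _ YL); have := LX _ YL; rewrite -{1}defX.
    case: (setD1_cases e Y) (eL _ YL) => [[_ defY]|[_ <-]] eY.
      by rewrite {3}defY (@wslUU e).
    rewrite (@triUr e) // (@wslUr e) // -cXb; case: (leqP #|Y|) => [le sYX _|lt _].
      by rewrite sup_below // (subset_trans sYX) // subsetUr.
    by rewrite wslC wsl_ltcard.
  - move=> Y YR; have := bR _ (imset_f _ YR); have := XR _ YR; rewrite -{1}defX.
    case: (setD1_cases e Y) (eR _ YR) => [[_ defY]|[_ <-]] eY.
      by rewrite {3}defY (@triUU e).
    rewrite !(@triUl e) // /tri; case: (leqP #|b |: X1|) => // lt XY sY.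
    apply/negPn/negP => /belowN[p [t /and5P[pXb pY tY tXb tp]]].
    move: tXb; rewrite !inE negb_or => /andP[tb tX].
    case/setU1P: pXb pY tp => [-> |pX1i] pY tp; last first.
      by have := belowE p t XY; move: tp; chase.
    have [|x /andP[xX xY]] := card_exDx _ tY tX; first by rewrite cXb in lt.
    have := surrE x t b sY; have := belowE x t XY; move: tp.
    by rewrite !inE eqxx (negbTE tb) xX orbT; chase.
move: bX'; have defX : X :\ e = X by case: (setD1_cases e X) => -[]; rewrite ?(negbTE eX).
rewrite defX => bX'; have eX' : lt_all e X by rewrite -defX; apply: eD.
have [okU|nU] := boolP ([forall Y in L, wsl Y (e |: X)] && [forall Y in R, tri (e |: X) Y]).
  by case/andP: okU => /forall_inP ? /forall_inP ?; exists e.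
(* For X equal to [G :\ e], adding [e] would give all of [G], which nothing obstructs. *)
have pX' : X \proper G :\ e.
  rewrite properEneq -{2}defX setSD // andbT; apply: contraNneq nU => ->.
  rewrite setD1K //; apply/andP; split; apply/forall_inP => Y YLR.
    have sY : Y \subset G by rewrite sG // inE YLR.
    by rewrite /wsl subset_leq_card // sub_surr.
  have sY : Y \subset G by rewrite sG // inE YLR orbT.
  rewrite /tri; case: ifP => [leGY|_]; last exact: sub_surr.
  by have/eqP-> : Y == G; rewrite ?sub_below // eqEcard sY.
have [b /setD1P[be bG] [bX bL bR]] := IHc _ _ _ _ cG' cut' pX' bX'.
have eXb : lt_all e (b |: X) by move=> x /setU1P[->|/eX' //]; apply: ltG; rewrite !inE be.
have cXb : #|b |: X| = #|X|.+1 by rewrite cardsU1 bX.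
have blockUL Y : Y \in L -> ~~ wsl Y (e |: X) ->
    [/\ lt_all e Y, #|Y| <= #|X|, below Y X, ~~ below X Y & surr Y (b |: X)].
  move=> YL; have := bL _ (imset_f _ YL); have := LX _ YL.
  case: (setD1_cases e Y) (eL _ YL) => [[_ defY]|[_ <-]] eY.
    rewrite {1 3}defY (@wslUU e) // => tYX _; suff -> : wsl (Y :\ e) X by [].
    by rewrite -defX; apply/tri_wsl/tri_del; rewrite ?defX //; apply: LX.
  rewrite (@wslUr e) // /tri; case: ifP => [le YX|_ ->] // sYb nXY; split=> //.
  by rewrite wsl_ltcard // cXb in sYb.
have blockUR Y : Y \in R -> ~~ tri (e |: X) Y ->
    [/\ lt_all e Y, #|Y| < #|X|, surr Y X, ~~ below X Y & surr Y (b |: X)].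
  move=> YR; have := bR _ (imset_f _ YR); have := XR _ YR.
  case: (setD1_cases e Y) (eR _ YR) => [[_ defY]|[_ <-]] eY.
    rewrite {1 3}defY (@triUU e) // => tYX _; suff -> : tri X (Y :\ e) by [].
    by rewrite -defX; apply/tri_del; rewrite ?defX //; apply: XR.
  rewrite (@triUl e) // /tri; case: leqP => [_ -> // | lt sYX].
  by rewrite leqNgt cXb (ltn_trans lt).
have blockSL Y : Y \in L -> ~~ wsl Y (b |: X) -> exists S,
    [/\ Y = e |: S, lt_all e S, #|X| < #|S|, below S X &
        ~~ below S (b |: X) && wsl S (b |: X)].
  move=> YL; have := bL _ (imset_f _ YL); have := LX _ YL.
  case: (setD1_cases e Y) (eL _ YL) => [[_ defY]|[_ <-]] eY; last by move=> _ ->.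
  rewrite {1 3}defY (@triUl e) // => YX wY; rewrite wslC (@wslUr e) // => nY.
  exists (Y :\ e); rewrite wY; move: nY.
  case: (leqP #|b |: X| #|Y :\ e|) => [|lt]; first by rewrite cXb => ? ->.
  by move: wY; rewrite wsl_ltcard // => ->.
have blockSR Y : Y \in R -> ~~ tri (b |: X) Y -> exists S,
    [/\ Y = e |: S, lt_all e S, X \subset S, b \notin S & tri (b |: X) S].
  move=> YR; have := bR _ (imset_f _ YR); have := XR _ YR.
  case: (setD1_cases e Y) (eR _ YR) => [[_ defY]|[_ <-]] eY; last by move=> _ ->.
  rewrite {1 3}defY !(@triUr e) // cXb ltnS => XY tY nY; exists (Y :\ e).
  move: XY nY (tY); rewrite {1}/tri cXb; case: (leqP #|X| #|Y :\ e|) => [le|lt].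
    rewrite leqW // => sXY; rewrite subUset sXY sub1set andbT => bY _; split=> //.
  by move=> _ nY; rewrite ltnNge (ltnW lt) /= (negbTE nY).
exists b => //; split=> // [Y YL|Y YR]; apply/negPn/negP => nY; move: nU;
  rewrite negb_and => /orP[] /forall_inPn[X' X'LR nX'].
- have [S [defY eS leS SX /andP[nS wS]]] := blockSL _ YL nY.
  have [eX1 leX X1X nX1 sX1] := blockUL _ X'LR nX'.
  apply: (add1_clash_LL bX leX X1X nX1 _ leS SX nS wS); first by rewrite /wsl sX1 cXb leqW.
  have := wL _ _ X'LR YL; rewrite defY (@wslUr e) //.
  by rewrite (leq_trans leX) // ltnW.
- have [S [defY eS leS SX /andP[nS wS]]] := blockSL _ YL nY.
  have [eX1 leX X1X nX1 sX1] := blockUR _ X'LR nX'.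
  apply: (add1_clash_RL bX leX X1X nX1 sX1 leS SX nS wS).
  by have := tLR _ _ YL X'LR; rewrite defY (@triUl e).
- have [S [defY eS sXS bS tS]] := blockSR _ YR nY.
  have [eX1 leX X1X nX1 sX1] := blockUL _ X'LR nX'.
  apply: (add1_clash_LR bX X1X nX1 sX1 sXS bS tS).
  have := tLR _ _ X'LR YR; rewrite defY (@triUr e) //.
  by rewrite leqW // (leq_trans leX) // subset_leq_card.
- have [S [defY eS sXS bS tS]] := blockSR _ YR nY.
  have [eX1 leX X1X nX1 sX1] := blockUR _ X'LR nX'.
  apply: (add1_clash_RR bX X1X nX1 sX1 sXS bS tS).
  have := wR _ _ X'LR YR; rewrite defY (@wslUr e) //.
  by rewrite (leq_trans (ltnW leX)) // subset_leq_card.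
Qed.
Lemma setDD_sub G X Y : Y \subset G -> (G :\: X) :\: (G :\: Y) = Y :\: X.
Proof.
move=> /subsetP sY; apply/setP => x; rewrite !inE; have := sY x.
by case: (x \in Y) => [->//|_]; case: (x \in G); rewrite /= ?andbF.
Qed.

Lemma card_setD_leq G X Y : X \subset G -> Y \subset G ->
  (#|G :\: X| <= #|G :\: Y|) = (#|Y| <= #|X|).
Proof.
move=> sX sY; rewrite !cardsD !(setIidPr _) //.
have := subset_leq_card sX; have := subset_leq_card sY; lia.
Qed.

Lemma tri_setD G X Y : X \subset G -> Y \subset G ->
  tri (G :\: X) (G :\: Y) = tri Y X.
Proof. by move=> sX sY; rewrite /tri card_setD_leq // /below /surr !setDD_sub. Qed.

Lemma wsl_setD G X Y : X \subset G -> Y \subset G ->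
  wsl (G :\: X) (G :\: Y) = wsl X Y.
Proof.
move=> sX sY; rewrite /wsl !card_setD_leq // /surr !setDD_sub //; exact: orbC.
Qed.

(* Complementation in [G] exchanges the two sides of a cut. *)
Lemma ex_del1 G L R X : cut G L R -> X \subset G -> X != set0 -> between L R X ->
  exists2 a, a \in X & (forall Y, Y \in L -> tri Y (X :\ a)) /\
                       (forall Y, Y \in R -> wsl Y (X :\ a)).
Proof.
move=> [sG wL wR tLR] sX /set0Pn[x0 x0X] /betweenP[LX XR].
pose D W := [set G :\: Y | Y in W].
have sL Y : Y \in L -> Y \subset G by move=> YL; rewrite sG // inE YL.
have sR Y : Y \in R -> Y \subset G by move=> YR; rewrite sG // inE YR orbT.
have cutD : cut G (D R) (D L).
  split.
  - by move=> _ /setUP[] /imsetP[Y _ ->]; exact: subsetDl.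
  - by move=> _ _ /imsetP[Y YR ->] /imsetP[Y' YR' ->]; rewrite wsl_setD; auto.
  - by move=> _ _ /imsetP[Y YR ->] /imsetP[Y' YR' ->]; rewrite wsl_setD; auto.
  - by move=> _ _ /imsetP[Y YR ->] /imsetP[Y' YR' ->]; rewrite tri_setD; auto.
have pX : G :\: X \proper G.
  rewrite properE subsetDl /=; apply/subsetPn; exists x0; rewrite ?inE ?x0X //.
  exact: (subsetP sX).
have bX : between (D R) (D L) (G :\: X).
  by apply/betweenP; split=> _ /imsetP[Y YL ->]; rewrite tri_setD; auto.
have [a aG [aX aL aR]] := ex_add1 cutD pX bX.
have aX' : a \in X by move: aX; rewrite inE aG andbT negbK.
have eX : a |: (G :\: X) = G :\: (X :\ a).
  by apply/setP => x; rewrite !inE; case: eqVneq => // ->; rewrite aG.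
have sXa : X :\ a \subset G by apply: subset_trans sX; exact: subD1set.
exists a => //; split=> Y YLR.
  by rewrite -(@tri_setD G) -?eX; auto; apply/aR/imset_f.
by rewrite -(@wsl_setD G) -?eX; auto; apply/aL/imset_f.
Qed.

(** [below] alone is not transitive. A violating pair [x], [z] lies entirely inside or entirely
    outside [Y]; comparison of sizes with [Y] then supplies a third element that contradicts the
    weak separation of [X] and [Z]. *)
Lemma below_trans X Y Z : #|X| <= #|Y| -> #|Y| <= #|Z| -> below X Y -> below Y Z ->
  wsl X Z -> below X Z.
Proof.
move=> leXY leYZ XY YZ wXZ; apply/negPn/negP => /belowN.
move=> [x [z /and5P[xX xZ zZ zX zx]]].
have eqY : (x \in Y) = (z \in Y).
  by move: zx; have := belowE x z XY; have := belowE x z YZ; chase.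
have [xY|xY] := boolP (x \in Y).
  have zY : z \in Y by rewrite -eqY.
  case/orP: wXZ => /andP[le sXZ].
    have [s /andP[sZ sY]] := card_exDx leYZ xY xZ.
    have := surrE z x s sXZ; have := belowE s z XY; have := belowE x s YZ; move: zx.
    by chase.
  have leYX : #|Y| <= #|X| by apply: leq_trans leYZ le.
  have [s /andP[sX sY]] := card_exDx leYX zY zX.
  have := surrE s z x sXZ; have := belowE s z XY; have := belowE x s YZ; move: zx.
  by chase.
have zY : z \notin Y by rewrite -eqY.
case/orP: wXZ => /andP[le sXZ].
  have [s /andP[sY sX]] := card_exDx leXY xX xY.
  have := surrE z x s sXZ; have := belowE x s XY; have := belowE s z YZ; move: zx.
  by chase.
have leZY : #|Z| <= #|Y| by apply: leq_trans le leXY.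
have [s /andP[sY sZ]] := card_exDx leZY zZ zY.
have := surrE s z x sXZ; have := belowE x s XY; have := belowE s z YZ; move: zx.
by chase.
Qed.

Lemma wsl_max m X Y : (forall x, x \in X -> f x < f m) -> (forall y, y \in Y -> f y < f m) ->
  wsl X (m |: Y) = tri X Y.
Proof.
move=> Xm Ym.
have mX : m \notin X by apply/negP => /Xm; rewrite ltnn.
have mY : m \notin Y by apply/negP => /Ym; rewrite ltnn.
have s1 : surr X (m |: Y) = below X Y.
  apply/surrP/belowP => [sXY x y xX xY yY yX|bXY b a b' aX].
    have := sXY y x m xX; rewrite !inE (negbTE xY) eqxx yY orbT.
    have -> : (x == m) = false by apply: contraNF mX => /eqP <-.
    move=> /(_ isT isT yX isT mX); have := Xm x xX; lia.
  rewrite !inE negb_or => /andP[am aY] /predU1P[->|bY] bX _ _; first by rewrite Xm.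
  by rewrite bXY.
have s2 : surr (m |: Y) X = surr Y X.
  apply/surrP/surrP => [sYX b a b' aY aX bX bY b'X b'Y|sYX b a b'].
    have neq c : c \in X -> c \notin Y -> c \notin m |: Y.
      by move=> cX cY; rewrite !inE negb_or cY andbT; apply: contraNneq mX => <-.
    by apply: sYX; rewrite ?neq // !inE aY orbT.
  rewrite !inE !negb_or => /predU1P[->|aY] aX bX /andP[_ bY] b'X /andP[_ b'Y].
    by rewrite (Xm b') // orbT.
  exact: sYX.
rewrite /wsl /tri s1 s2 cardsU1 mY add1n.
case: (ltngtP #|X| #|Y|) => [lt|lt|eq].
- by rewrite leqW ?(ltnW lt) //= orbF.
- have [->|ne] := eqVneq #|X| #|Y|.+1.
    by rewrite leqnn /= orb_idl //; exact: below_surrC.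
  by rewrite leqNgt ltn_neqAle eq_sym ne lt.
- by rewrite eq leqnSn orbF.
Qed.

Lemma wslUU_notin m X Y : m \notin X -> m \notin Y ->
  wsl (m |: X) (m |: Y) = wsl X Y.
Proof. by move=> mX mY; rewrite /wsl /surr !setDUU // !cardsU1 mX mY. Qed.

(** * Separated families with sizes in an interval *)

Definition lsep lo hi G W : bool :=
  [forall X in W, [&& X \subset G, lo <= #|X| & #|X| <= hi]] &&
  [forall X in W, forall Y in W, wsl X Y].

Lemma lsepP lo hi G W :
  reflect ((forall X, X \in W -> [&& X \subset G, lo <= #|X| & #|X| <= hi]) /\
           {in W &, forall X Y, wsl X Y}) (lsep lo hi G W).
Proof.
apply: (iffP andP) => -[/forall_inP sW wW]; split=> //.
  by move=> X Y XW YW; move/forall_inP: wW => /(_ X XW)/forall_inP; apply.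
by apply/forall_inP => X XW; apply/forall_inP => Y; apply: wW.
Qed.

Lemma wslxx X : wsl X X.
Proof. by rewrite /wsl leqnn sub_surr. Qed.

Lemma lsep_max_in lo hi G W X : maxset (lsep lo hi G) W ->
  [&& X \subset G, lo <= #|X| & #|X| <= hi] -> (forall Y, Y \in W -> wsl X Y) ->
  X \in W.
Proof.
move=> /maxsetP[/lsepP[sW wW] mW] sX wX.
rewrite -(mW (X |: W)) ?setU11 ?subsetUr //; apply/lsepP; split.
  by move=> Y /setU1P[-> //|]; apply: sW.
move=> Y Z /setU1P[->|YW] /setU1P[->|ZW]; rewrite ?wslxx //; first exact: wX.
- by rewrite wslC wX.
- exact: wW.
Qed.

Lemma below_anti X Y : #|X| = #|Y| -> below X Y -> below Y X -> X = Y.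
Proof.
move=> eqXY XY YX; have leYX : #|Y| <= #|X| by rewrite eqXY.
apply/eqP; rewrite eqEcard leYX andbT; apply/negPn/negP => /subsetPn[x xX xY].
have [y /andP[yY yX]] := card_exDx (eq_leq eqXY) xX xY.
by have := belowE x y XY; have := belowE y x YX; chase.
Qed.

(** What has to be excluded is proper surrounding. When [X] has elements on both sides of [Z], some
    element of [Z :\ x] is enclosed by [X], although [Z :\ x] is smaller and must surround [X]; when
    [Z] surrounds, [b |: Z] plays this part with the roles exchanged. *)
Lemma below_of_adj X Z x b : #|X| = #|Z| -> b \notin Z -> x \in Z ->
  wsl X Z -> wsl X (b |: Z) -> wsl X (Z :\ x) -> below X Z \/ below Z X.
Proof.
move=> eqXZ bZ xZ wXZ wb wx.
have cb : #|b |: Z| = #|X|.+1 by rewrite cardsU1 bZ eqXZ.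
have cx : #|X| = #|Z :\ x|.+1 by rewrite eqXZ [#|Z|](cardsD1 x) xZ.
have sb : surr X (b |: Z) by rewrite wsl_ltcard ?cb in wb.
have sx : surr (Z :\ x) X by rewrite wslC wsl_ltcard ?cx in wx.
have [XZ|/belowN] := boolP (below X Z); first by left.
have [ZX|/belowN] := boolP (below Z X); first by right.
move=> [z1 [x1 /and5P[z1Z z1X x1X x1Z lt1]]] [x2 [z2 /and5P[x2X x2Z z2Z z2X lt2]]].
case/orP: wXZ => /andP[_ sXZ].
  have x12 : x1 != x2.
    apply: contraTneq lt1 => eq12; have := surrE z2 x2 z1 sXZ; move: lt2.
    by rewrite eq12; chase.
  have [||t /andP[tZx tX]] := card_exDxx (eq_leq cx) x1X _ x2X _ x12.
  - by rewrite !inE (negbTE x1Z) andbF.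
  - by rewrite !inE (negbTE x2Z) andbF.
  have := surrE x1 t x2 sx; have := surrE t x1 z1 sXZ; have := surrE z2 x1 z1 sXZ.
  have := surrE z2 x2 z1 sXZ; have := surrE z2 x2 t sXZ.
  have [_ tZ] := setD1P tZx; rewrite !in_setD1 in tZx *.
  by rewrite tZx (negbTE x1Z) (negbTE x2Z) !andbF; move: lt1 lt2; chase.
have z12 : z1 != z2.
  apply: contraTneq lt1 => eq12; have := surrE x1 z2 x2 sXZ; move: lt2.
  by rewrite eq12; chase.
have [s /andP[sX sbZ]] := card_exDxx (eq_leq cb) (setU1r b z1Z) z1X (setU1r b z2Z) z2X z12.
have := surrE z2 s z1 sb; have := surrE s z2 x2 sXZ; have := surrE x1 z1 x2 sXZ.
have := surrE x1 z2 x2 sXZ; have := surrE x1 z1 s sXZ; move: sbZ.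
by rewrite !in_setU1 negb_or => /andP[/negbTE-> sZ]; rewrite z1Z z2Z !orbT; move: lt1 lt2; chase.
Qed.

(** * Deletion of the maximum *)

Section MaxElement.
Variables (lo hi : nat) (G : {set T}) (W : {set {set T}}) (m : T).
Hypotheses (mG : m \in G) (maxm : forall x, x \in G :\ m -> f x < f m).
Hypotheses (lohi : lo <= hi) (hiG : hi <= #|G|) (mW : maxset (lsep lo hi G) W).

Let L := [set X in W | m \notin X].
Let R := [set X : {set T} | (m \notin X) && (m |: X \in W)].

Let sW X : X \in W -> [&& X \subset G, lo <= #|X| & #|X| <= hi].
Proof. by case/maxsetP: mW => /lsepP[sW _] _; apply: sW. Qed.

Let wW X Y : X \in W -> Y \in W -> wsl X Y.
Proof. by case/maxsetP: mW => /lsepP[_ wW] _; apply: wW. Qed.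

Let lt_m X : X \subset G :\ m -> forall x, x \in X -> f x < f m.
Proof. by move=> /subsetP sX x /sX/maxm. Qed.

Let m_notin X : X \subset G :\ m -> m \notin X.
Proof. by move=> sX; apply/negP => /(lt_m sX); rewrite ltnn. Qed.

Let sub_G X : X \subset G :\ m -> X \subset G.
Proof. by move/subset_trans; apply; exact: subD1set. Qed.

Let Lsub X : X \in L -> X \subset G :\ m.
Proof.
by rewrite inE => /andP[/sW/and3P[sX _ _] mX]; rewrite subsetD1 sX.
Qed.

Let Rsub X : X \in R -> X \subset G :\ m.
Proof.
rewrite inE => /andP[mX /sW/and3P[sX _ _]]; rewrite subsetD1 mX andbT.
by apply: subset_trans sX; exact: subsetUr.
Qed.

Let Lcard X : X \in L -> lo <= #|X| <= hi.
Proof. by rewrite inE => /andP[/sW/and3P[_ -> ->]]. Qed.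

Let Rcard X : X \in R -> lo <= #|X|.+1 <= hi.
Proof. by rewrite inE => /andP[mX /sW/and3P[_]]; rewrite cardsU1 mX => -> ->. Qed.

Let cutLR : cut (G :\ m) L R.
Proof.
split=> [X /setUP[/Lsub|/Rsub]//|X Y|X Y|X Y].
- by rewrite !inE => /andP[XW _] /andP[YW _]; exact: wW.
- rewrite !inE => /andP[mX XW] /andP[mY YW].
  by rewrite -(wslUU_notin mX mY) wW.
- move=> /[dup] XL /Lsub/lt_m mX /[dup] YR /Rsub/lt_m mY.
  rewrite -(wsl_max mX mY); move: XL YR; rewrite !inE => /andP[XW _] /andP[_ YW].
  exact: wW.
Qed.

Let memL X : X \subset G :\ m -> lo <= #|X| <= hi -> (forall Y, Y \in L -> wsl X Y) ->
  (forall Y, Y \in R -> tri X Y) -> X \in L.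
Proof.
move=> sX cX wX tX; rewrite inE m_notin // andbT (lsep_max_in mW) ?sub_G //.
move=> Y YW; have [mY|mY] := boolP (m \in Y); last by rewrite wX // inE YW mY.
have YR : Y :\ m \in R by rewrite inE setD1K // YW !inE eqxx.
by rewrite -(setD1K mY) wsl_max; [exact: tX|exact: lt_m|apply/lt_m/Rsub].
Qed.

Let memR X : X \subset G :\ m -> lo <= #|X|.+1 <= hi -> (forall Y, Y \in L -> tri Y X) ->
  (forall Y, Y \in R -> wsl X Y) -> X \in R.
Proof.
move=> sX cX tX wX; rewrite inE m_notin //= (lsep_max_in mW) //.
  by rewrite cardsU1 m_notin // subUset sub1set mG sub_G.
move=> Y YW; have [mY|mY] := boolP (m \in Y).
  have YR : Y :\ m \in R by rewrite inE setD1K // YW !inE eqxx.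
  by rewrite -(setD1K mY) wslUU_notin ?m_notin ?wX //; apply: Rsub.
have YL : Y \in L by rewrite inE YW mY.
by rewrite wslC wsl_max; [exact: tX|apply/lt_m/Lsub|exact: lt_m].
Qed.

Let cardW : #|W| = #|L| + #|R|.
Proof.
rewrite -(cardsID [set X : {set T} | m \notin X] W); congr (_ + _).
  by apply: eq_card => X; rewrite !inE.
have injU : {in R &, injective (fun X => m |: X)}.
  move=> X Y; rewrite !inE => /andP[mX _] /andP[mY _] eqXY.
  by rewrite -(setU1K mX) eqXY setU1K.
rewrite -(card_in_imset injU); apply: eq_card => X; apply/idP/imsetP.
  rewrite !inE negbK => /andP[mX XW]; exists (X :\ m); last by rewrite setD1K.
  by rewrite !inE eqxx setD1K.
by case=> Y; rewrite inE => /andP[_ YW] ->; rewrite !inE eqxx.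
Qed.

Let level k : lo <= k < hi -> exists2 Z, Z \in L :&: R & #|Z| = k.
Proof.
move=> /andP[lok khi].
have kG : k <= #|G :\ m|.
  by rewrite -ltnS (leq_trans khi) // (leq_trans hiG) // [#|G|](cardsD1 m) mG.
have [Z sZ [cZ /betweenP[LZ ZR]]] := ex_between cutLR kG.
exists Z => //; rewrite inE memL ?memR ?cZ ?lok ?(ltnW khi) ?khi ?(leqW lok) //.
- by move=> Y YR; apply: tri_wsl => //; apply: ZR.
- by move=> Y YL; rewrite wslC; apply: tri_wsl => //; apply: LZ.
Qed.

Let betweenLR Z : Z \in L :&: R -> between L R Z.
Proof.
move=> /setIP[ZL ZR]; have [_ _ _ tLR] := cutLR.
by apply/betweenP; split=> Y YLR; apply: tLR.
Qed.

(** Membership of [Z] in [R] gives |Z| < hi, which leaves room for [b]; dually, in [delR],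
    membership in [L] gives |Z| >= lo. *)
Let addL Z : Z \in L :&: R -> Z \proper G :\ m -> exists2 b, b \notin Z & b |: Z \in L.
Proof.
move=> ZLR pZ; have [b bG [bZ Lb Rb]] := ex_add1 cutLR pZ (betweenLR ZLR).
case/setIP: ZLR => /Lcard cL /Rcard cR.
exists b => //; apply: memL => //.
- by rewrite subUset sub1set bG proper_sub.
- by rewrite cardsU1 bZ; move: cL cR; clear; lia.
- by move=> Y YL; rewrite wslC Lb.
Qed.

Let delR Z : Z \in L :&: R -> Z != set0 -> exists2 x, x \in Z & Z :\ x \in R.
Proof.
move=> ZLR nZ; have sZ : Z \subset G :\ m by case/setIP: ZLR => /Lsub.
have [x xZ [Lx Rx]] := ex_del1 cutLR sZ nZ (betweenLR ZLR).
case/setIP: ZLR => /Lcard cL /Rcard cR.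
exists x => //; apply: memR => //.
- by apply: subset_trans sZ; exact: subD1set.
- by move: cL cR; rewrite (cardsD1 x) xZ; clear; lia.
- by move=> Y YR; rewrite wslC Rx.
Qed.

(** Cardinality is a bijection from [L :&: R] to the levels k with lo <= k < hi: two members of
    equal size are [below] each other in both directions. *)
Let cardLR : #|L :&: R| = hi - lo.
Proof.
rewrite cardE -(size_map (fun Z : {set T} => #|Z|)) -(size_iota lo (hi - lo)).
apply/perm_size/uniq_perm; last first.
- move=> k; rewrite mem_iota subnKC //; apply/mapP/idP => [[Z]|/level[Z ZLR <-]].
    by rewrite mem_enum => /setIP[/Lcard/andP[le _] /Rcard/andP[_ lt]] ->; rewrite le.
  by exists Z; rewrite ?mem_enum.
- exact: iota_uniq.
rewrite map_inj_in_uniq ?enum_uniq // => X Y; rewrite !mem_enum => XLR YLR eqXY.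
have [_ _ _ tLR] := cutLR; case/setIP: XLR YLR => XL XR /setIP[YL YR].
have := tLR _ _ XL YR; have := tLR _ _ YL XR; rewrite /tri eqXY leqnn.
by move=> YX XY; apply: below_anti.
Qed.

Let lsepLR : lsep lo.-1 (minn hi #|G :\ m|) (G :\ m) (L :|: R).
Proof.
have [_ wL wR tLR] := cutLR; apply/lsepP; split.
  move=> X XLR; have sX : X \subset G :\ m by case/setUP: XLR => [/Lsub|/Rsub].
  rewrite sX leq_min (subset_leq_card sX) andbT.
  by case/setUP: XLR => [/Lcard|/Rcard]; clear; lia.
move=> X Y /setUP[XL|XR] /setUP[YL|YR]; [exact: wL| | |exact: wR].
- by apply: tri_wsl => //; apply: tLR.
- by rewrite wslC; apply: tri_wsl => //; apply: tLR.
Qed.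

(** Let [Z] be separated from [L :|: R], and let [Z0] in [L :&: R] have the same size. The
    neighbours of [Z0] in [L] and in [R] force [Z] and [Z0] to be comparable, and [below_trans]
    through [Z0] gives the [tri] conditions that put [Z] into [L] or [R]. *)
Let maxLR : maxset (lsep lo.-1 (minn hi #|G :\ m|) (G :\ m)) (L :|: R).
Proof.
apply/maxsetP; split=> // V /lsepP[sV wV] sLRV; apply/eqP; rewrite eqEsubset sLRV andbT.
apply/subsetP => Z ZV; have /and3P[sZ loZ] := sV _ ZV; rewrite leq_min => /andP[hiZ _].
have wZ X : X \in L :|: R -> wsl Z X by move=> XLR; apply: wV => //; apply: (subsetP sLRV).
have wZL X : X \in L -> wsl Z X by move=> XL; apply: wZ; rewrite inE XL.
have wZR X : X \in R -> wsl Z X by move=> XR; apply: wZ; rewrite inE XR orbT.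
(* The extreme sizes lo - 1 and hi carry no [Z0]. There [Z] is smaller than all of [L], or larger
   than all of [R], so weak separation already is the surrounding branch of [tri]. *)
have [ltZ|geZ] := ltnP #|Z| lo.
  apply/setUP; right; apply: memR => // [|Y YL]; first by move: ltZ lohi loZ; clear; lia.
  have /andP[loY _] := Lcard YL; have ltY : #|Z| < #|Y| by apply: leq_trans loY.
  by rewrite /tri leqNgt ltY; move: (wZL _ YL); rewrite wsl_ltcard.
have [eqZ|neZ] := eqVneq #|Z| hi.
  apply/setUP; left; apply: memL => // [|Y YR]; first by rewrite geZ.
  have /andP[_ hiY] := Rcard YR; have ltY : #|Y| < #|Z| by rewrite eqZ.
  by rewrite /tri leqNgt ltY; move: (wZR _ YR); rewrite wslC wsl_ltcard.
have ltZ : #|Z| < hi by rewrite ltn_neqAle neZ.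
have [|Z0 ZLR eqZ] := @level #|Z|; first by rewrite geZ.
have [_ _ _ tLR] := cutLR; have /betweenP[LZ ZR] := betweenLR ZLR.
have : below Z Z0 \/ below Z0 Z.
  (* A neighbour is missing only if [Z0] is the whole ground set or empty; then [Z] equals it by
     size. *)
  have [pZ|] := boolP (Z0 \proper G :\ m); last first.
    have sZ0 : Z0 \subset G :\ m by case/setIP: ZLR => /Lsub.
    rewrite properEcard sZ0 eqZ -leqNgt => leZ; left.
    suff -> : Z = G :\ m.
      by apply: sup_below => //.
    by apply/eqP; rewrite eqEcard sZ.
  have [Z00|nZ] := eqVneq Z0 set0.
    move: eqZ; rewrite Z00 cards0 => /esym/cards0_eq->; left; exact: sub_below.
  have [b bZ bL] := addL ZLR pZ; have [x xZ xR] := delR ZLR nZ.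
  by apply: (@below_of_adj _ _ x b) => //; auto; apply: wZ; rewrite inE; case/setIP: ZLR => ->.
case=> [ZZ0|Z0Z]; apply/setUP.
  left; apply: memL => // [|Y YR]; first by rewrite geZ.
  have := ZR _ YR; have := wZR _ YR; rewrite /tri eqZ; case: leqP => [le w Z0Y|lt].
    by apply: (@below_trans _ Z0); rewrite ?eqZ.
  by rewrite wslC wsl_ltcard.
right; apply: memR => // [|Y YL]; first by rewrite ltZ leqW.
have := LZ _ YL; have := wZL _ YL; rewrite /tri eqZ; case: leqP => [le w YZ0|lt].
  by apply: (@below_trans _ Z0); rewrite ?eqZ // wslC.
by rewrite wsl_ltcard.
Qed.

Lemma lsep_card_step : exists2 V, maxset (lsep lo.-1 (minn hi #|G :\ m|) (G :\ m)) V &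
  #|W| = #|V| + (hi - lo).
Proof. by exists (L :|: R); rewrite // cardW -cardLR -cardsUI. Qed.

End MaxElement.

(** With g = |G| this says |W| = C(g+1, 2) + 1 - C(lo+1, 2) - C(g-hi+1, 2), doubled and rearranged
    to stay in [nat]: each excluded size k costs k + 1 below lo and g - k + 1 above hi. *)
Lemma lsep_card lo hi G W : lo <= hi -> hi <= #|G| -> maxset (lsep lo hi G) W ->
  2 * #|W| + lo * lo.+1 + (#|G| - hi) * (#|G| - hi).+1 = #|G| * #|G|.+1 + 2.
Proof.
move eqc: #|G| => c; elim: c => [|c IHc] in lo hi G W eqc *.
  move=> lohi; rewrite leqn0 => /eqP hi0 mW.
  have lo0 : lo = 0 by move: lohi; rewrite hi0; case: (lo).
  have G0 := cards0_eq eqc.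
  suff -> : W = [set set0] by rewrite cards1 hi0 lo0.
  apply/setP => X; rewrite inE; apply/idP/eqP => [XW|->].
    by case/maxsetP: mW => /lsepP[sW _] _; have /and3P[] := sW _ XW; rewrite G0 subset0 => /eqP.
  apply: (lsep_max_in mW) => [|Y _]; first by rewrite sub0set cards0 lo0.
  by rewrite /wsl cards0 sub_surr ?sub0set.
move=> lohi hiG mW.
have [x0 x0G] : exists x, x \in G by apply/set0Pn; rewrite -card_gt0 eqc.
pose m := [arg max_(x > x0 in G) f x].
have [mG maxm] : m \in G /\ forall x, x \in G :\ m -> f x < f m.
  rewrite /m; case: (arg_maxnP (fun x => f x) x0G) => y yG ymax; split=> // x.
  rewrite !inE => /andP[ne xG].
  have : f x <= f y by apply: ymax.
  by rewrite leq_eqVlt => /predU1P[/f_inj e|//]; rewrite e eqxx in ne.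
have hiG' : hi <= #|G| by rewrite eqc.
have [V mV ->] := lsep_card_step mG maxm lohi hiG' mW.
have cG' : #|G :\ m| = c by move: eqc; rewrite (cardsD1 m) mG => -[].
rewrite cG' in mV.
have lec : lo.-1 <= minn hi c by move: lohi hiG; clear; lia.
have := IHc _ _ _ _ cG' lec (geq_minr _ _) mV; move: #|V| lohi hiG; clear => v lohi hiG.
(* For lo = 0 the truncated predecessor is harmless, since l (l + 1) vanishes at 0 and at -1. *)
have -> : lo.-1 * lo.-1.+1 = lo * lo.+1 - 2 * lo.
  by case: (lo) => [|l] //; rewrite -[l.+2]addn2 mulnDr [2 * _]mulnC addnK mulnC.
have : 2 * lo <= lo * lo.+1 by rewrite mulnC leq_mul2l; case: (lo).
move: hiG lohi; rewrite leq_eqVlt ltnS => /predU1P[->|hic] lohi.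
  rewrite (minn_idPr (leqnSn c)) !subnn; move: (lo * lo.+1) => a; nia.
rewrite (minn_idPl hic) subSn //.
have : c = hi + (c - hi) by rewrite subnKC.
move: (c - hi) (lo * lo.+1) => d a ->; nia.
Qed.

End LinearOrder.

(** * Cyclic separation and the purity of all r-sets *)

Lemma rot_modE n (j x : 'I_n) : (x + (n - j)) %% n = if j <= x then x - j else x + n - j.
Proof.
have := ltn_ord j; have := ltn_ord x; move: (nat_of_ord x) (nat_of_ord j) => {x j} x j.
case: (leqP j x) => [le xn jn|lt xn jn].
  have -> : x + (n - j) = x - j + n by lia.
  by rewrite modnDr modn_small //; lia.
by rewrite modn_small; lia.
Qed.

Lemma cyc_ltE n (j x y : 'I_n) :
  cyc_lt j x y = [|| x < y < j, j <= x < y | y < j <= x].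
Proof.
have := ltn_ord j; have := ltn_ord x; have := ltn_ord y; rewrite /cyc_lt !rot_modE.
by case: (leqP j x); case: (leqP j y); lia.
Qed.

Lemma cyc_llP n (j : 'I_n) (X Y : {set 'I_n}) :
  reflect (forall x y, x \in X -> x \notin Y -> y \in Y -> y \notin X -> cyc_lt j x y)
    (cyc_ll j X Y).
Proof.
apply: (iffP forall_inP) => [ll x y xX xY yY yX|ll x].
  by have := ll x; rewrite inE xX xY => /(_ isT)/forall_inP/(_ y); rewrite inE yX yY; apply.
by rewrite inE => /andP[xY xX]; apply/forall_inP => y; rewrite inE => /andP[yX yY]; apply: ll.
Qed.

(** Surrounding is cyclic separation read from a suitable start [j]. If [X] surrounds [Y], start at
    the first element of [X :\: Y] that has some of [Y :\: X] before it (at 0 if there is none); if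
    [Y] surrounds [X], start at the first element of [X :\: Y]. *)
Lemma wsep_surr n (X Y : {set 'I_n}) : 0 < n ->
  wsep X Y = surr (@nat_of_ord n) X Y || surr (@nat_of_ord n) Y X.
Proof.
move=> n0; pose f := @nat_of_ord n; have f_inj : injective f := @ord_inj n.
have surrP' A B := surrP f_inj A B.
apply/existsP/orP => [[j /cyc_llP ll]|[/surrP' s|/surrP' s]].
- have [sXY|/(surrN f_inj)[b [a [b']]]] := boolP (surr f X Y); first by left.
  move=> /and5P[aX aY bY bX /and3P[b'Y b'X /andP[ba ab]]].
  right; apply/surrP' => x y x' yY yX xX xY x'X x'Y.
  have := ll a b aX aY bY bX; have := ll a b' aX aY b'Y b'X.
  have := ll x y xX xY yY yX; have := ll x' y x'X x'Y yY yX.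
  have := ll x b xX xY bY bX; have := ll x b' xX xY b'Y b'X.
  have := ll x' b x'X x'Y bY bX; have := ll x' b' x'X x'Y b'Y b'X.
  have := ll a y aX aY yY yX.
  by rewrite !cyc_ltE; move: ba ab; rewrite /f /=; clear; lia.
- have [/existsP[x0 Px0]|/existsPn no] := boolP [exists x in X :\: Y, exists y in Y :\: X, y < x].
    pose P x := (x \in X :\: Y) && [exists y in Y :\: X, y < x].
    case: (@arg_minnP _ x0 P f Px0) => j; rewrite /P !inE => /andP[/andP[jY jX]].
    move=> /exists_inP[y0]; rewrite inE => /andP[y0X y0Y] y0j jmin.
    exists j; apply/cyc_llP => x y xX xY yY yX; rewrite cyc_ltE.
    have := s y0 j y jX jY y0Y y0X yY yX.
    have : (y < x) ==> (j <= x).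
      apply/implyP => yx; apply: jmin; rewrite !inE xX xY.
      by apply/exists_inP; exists y; rewrite // inE yY yX.
    have : (y != x :> nat) by apply: contraNneq yX => /ord_inj->.
    by move: y0j; rewrite /f /=; clear; lia.
  exists (Ordinal n0); apply/cyc_llP => x y xX xY yY yX; rewrite cyc_ltE /=.
  have := no x; rewrite inE xX xY /= => /exists_inPn/(_ y); rewrite inE yX yY => /(_ isT).
  have : (y != x :> nat) by apply: contraNneq yX => /ord_inj->.
  by clear; lia.
have [e|/set0Pn[x0 Px0]] := eqVneq (X :\: Y) set0.
  exists (Ordinal n0); apply/cyc_llP => x y xX xY.
  by have : x \in X :\: Y by [rewrite inE xX xY]; rewrite e inE.
case: (@arg_minnP _ x0 (mem (X :\: Y)) f Px0) => j; rewrite /= inE => /andP[jY jX] jmin.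
exists j; apply/cyc_llP => x y xX xY yY yX; rewrite cyc_ltE.
have := s j y x yY yX jX jY xX xY; have := jmin x; rewrite inE xX xY => /(_ isT).
have : (y != x :> nat) by apply: contraNneq yX => /ord_inj->.
have : (y != j :> nat) by apply: contraNneq yX => /ord_inj->.
by rewrite /f /=; clear; lia.
Qed.

Lemma wsepC n (X Y : {set 'I_n}) : 0 < n -> wsep X Y = wsep Y X.
Proof. by move=> n0; rewrite !wsep_surr // orbC. Qed.

Definition ksets n r : {set {set 'I_n}} := [set X : {set 'I_n} | #|X| == r].

Lemma max_separated_card n r (W : {set {set 'I_n}}) : 0 < n -> r <= n ->
  max_separated (ksets n r) W -> #|W| = r * (n - r) + 1.
Proof.
move=> n0 rn mW.
have {}mW : maxset (lsep (@nat_of_ord n) r r setT) W.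
  pose P (S : {set {set 'I_n}}) := (S \subset ksets n r) && separated S.
  rewrite -(@maxset_eq _ P) // => S; rewrite /P.
  rewrite /lsep; have eqS : (S \subset ksets n r) =
      [forall X in S, [&& X \subset setT, r <= #|X| & #|X| <= r]].
    have eqX (X : {set 'I_n}) :
        (X \in ksets n r) = [&& X \subset [set: 'I_n], r <= #|X| & #|X| <= r].
      by rewrite inE subsetT eqn_leq andbC.
    by apply/subsetP/forall_inP => sS X /sS; rewrite eqX.
  rewrite -eqS; apply: andb_id2l => /subsetP sS.
  apply: eq_forallb_in => X XS; apply: eq_forallb_in => Y YS.
  move: (sS X XS) (sS Y YS); rewrite !inE => /eqP cX /eqP cY.
  by rewrite wsep_surr // /wsl cX cY leqnn.
have := lsep_card (@ord_inj n) (leqnn r) _ mW.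
rewrite cardsT card_ord => /(_ rn).
move: #|W| rn; clear => w /subnKC; move: (n - r) => d <-; nia.
Qed.

Import Order.TTheory GRing.Theory Num.Theory.

Ltac zlia := repeat match goal with H : ?P |- _ =>
    lazymatch P with
    | is_true ?b => lazymatch b with
        | context [@Order.le] => fail | context [@Order.lt] => fail | _ => clear H end
    | forall _, _ => clear H
    end
  end; lia.

(** * The winding number of the gap *)

Section Winding.
Local Open Scope ring_scope.
(* Elements and times are lifted from residues modulo [n] to integers: [M i q]
   stands for [q \in N i], and [w i] is a gap at time [i]. *)
Variables (n : int) (M : int -> int -> bool) (X Y : int -> bool) (w : int -> int).
Variables (t e : int).
Hypothesis n0 : 0 < n.
Hypothesis M_per : forall i q, M i (q + n) = M i q.
Hypothesis M_pert : forall i q, M (i + n) q = M i q.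
Hypothesis X_per : forall q, X (q + n) = X q.
Hypothesis Y_per : forall q, Y (q + n) = Y q.
Hypothesis M_diag : forall i, M i i.
Hypothesis M_step : forall i q, i < q -> q < i + n -> M i q -> M (i + 1) q.
Hypothesis M_new : forall i c d, c < d -> d < c + n ->
  M (i + 1) c -> ~~ M i c -> M (i + 1) d -> M i d.
Hypothesis M_card : forall i q, M i q -> ~~ X q ->
  exists2 x, i <= x < i + n & X x && ~~ M i x.
Hypothesis X_int : forall i p q, i <= p < i + n -> i <= q < i + n ->
  M i p -> ~~ X p -> X q -> ~~ M i q -> p < q.

Definition pos i q := M i q && ~~ Y q.
Definition neg i q := ~~ M i q && Y q.

Hypothesis w_gap : forall i p q, t <= i <= e -> pos i p -> neg i q ->
  w i <= q -> q < p -> p < w i + n -> False.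
Hypothesis w_step : forall i q, t <= i -> i < e -> pos (i + 1) q || neg (i + 1) q ->
  (q < w i) = (q < w (i + 1)).

Lemma int_ind_from (P : int -> Prop) (s : int) : P s ->
  (forall i, s <= i -> P i -> P (i + 1)) -> forall i, s <= i -> P i.
Proof.
move=> Ps IH i si; have [k ->] : exists k : nat, i = s + k%:Z by exists `|i - s|%N; zlia.
elim: k {i si} => [|k IHk]; first by rewrite addr0.
by rewrite -addn1 PoszD addrA; apply: IH; rewrite ?lerDl.
Qed.

Lemma per_mul (T : Type) (f : int -> T) : (forall q, f (q + n) = f q) ->
  forall q k, f (q + k * n) = f q.
Proof.
move=> fP q k; have fN r : f (r - n) = f r by rewrite -(fP (r - n)) subrK.
elim: k => [|k IH|k IH]; first by rewrite mul0r addr0.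
  by rewrite -addn1 PoszD mulrDl mul1r addrA fP.
by rewrite -addn1 PoszD opprD mulrDl mulN1r addrA fN.
Qed.

Lemma pos_mul i q k : pos i (q + k * n) = pos i q.
Proof. by apply: (per_mul (f := pos i)) => p; rewrite /pos M_per Y_per. Qed.

Lemma neg_mul i q k : neg i (q + k * n) = neg i q.
Proof. by apply: (per_mul (f := neg i)) => p; rewrite /neg M_per Y_per. Qed.

(** An element can leave only at a step indexed by its own residue, and [q] is the first such index
    from [i] on. *)
Lemma persist i j q : i <= j -> j <= q -> q < i + n -> M i q -> M j q.
Proof.
move=> ij; move: j ij q; apply: int_ind_from => // k ik IH q kq qn Mi.
by apply: M_step; [zlia|zlia|apply: IH => //; zlia].
Qed.

Lemma track i j q : t <= i -> i <= j -> j <= e ->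
  (forall k, i < k <= j -> pos k q || neg k q) -> (q < w i) = (q < w j).
Proof.
move=> ti ij; move: j ij; apply: int_ind_from => // k ik IH ke sgn.
rewrite IH; [|zlia|by move=> l ?; apply: sgn; zlia].
by apply: w_step; [zlia|zlia|apply: sgn; zlia].
Qed.

(* The gap just behind [a] at time [a] follows an element that keeps its sign up to
   time [c], or first [d] and then [c] from the time [c] enters the necklace. *)
Lemma half_turn a c d k : t <= a -> c <= e -> a < c -> c < d -> d < a + n ->
  ~~ Y a -> X c -> ~~ Y c -> ~~ X d -> Y d ->
  (forall q, d - n <= q -> q < a -> X q -> Y q) ->
  a + k * n - n < w a -> w a <= a + k * n ->
  c + k * n - n < w c /\ w c <= c + k * n.
Proof.
move=> ta ce ac cd da Ya Xc Yc Xd Yd first wa1 wa2.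
have posa : pos a a by rewrite /pos M_diag.
have posc i : pos i c = M i c by rewrite /pos Yc andbT.
have negd i : neg i d = ~~ M i d by rewrite /neg Yd andbT.
have gap i p q : t <= i <= e -> pos i p -> neg i q -> w i <= q + k * n ->
    q < p -> p + k * n < w i + n -> False.
  move=> ti pp nq wq qp pw; apply: (w_gap ti (p := p + k * n) (q := q + k * n)) => //.
  - by rewrite pos_mul.
  - by rewrite neg_mul.
  - zlia.
have trackK i j q l : t <= i -> i <= j -> j <= e ->
    (forall k, i < k <= j -> pos k q || neg k q) -> (q + l * n < w i) = (q + l * n < w j).
  by move=> ti ij je sgn; apply: track => // m im; rewrite pos_mul neg_mul; apply: sgn.
have tae : t <= a <= e by zlia.
(* Here [c] is positive from [a] to [c], so only [w a] has to be located: a negative [x] between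
   [d - n] and [a] confines it to the interval from [x + k * n] to [a + k * n]. *)
have [Mac|Mac] := boolP (M a c).
  have [x [x1 x2 negx]] : exists x, [/\ d - n <= x, x < a & neg a x].
    have [Mad|Mad] := boolP (M a d); last first.
      by exists (d - n); split; [zlia|zlia|rewrite -(neg_mul _ _ 1) mul1r subrK negd].
    have [x xa /andP[Xx Mx]] := M_card Mad Xd.
    have dx : d < x by apply: (X_int (i := a)) => //; zlia.
    have negx : neg a (x - n).
      rewrite /neg -M_per subrK Mx first //; [zlia|zlia|by rewrite -X_per subrK].
    by exists (x - n); split; [zlia|zlia|].
  have xw : x + k * n < w a.
    rewrite ltNge; apply/negP => xw.
    by apply: (gap a a x) => //; zlia.
  have sgn i : a < i <= c -> pos i c || neg i c.
    by move=> ai; rewrite posc (persist _ _ _ Mac) //; zlia.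
  have := trackK a c c k ta (ltW ac) ce sgn.
  have := trackK a c c (k - 1) ta (ltW ac) ce sgn.
  by rewrite mulrBl mul1r; zlia.
(* Since [X] is in the interior, [d] cannot be present while [c] is absent. As only one element
   enters at a step, [d] is still absent just after [c] enters. *)
have Mcd i : a <= i <= c -> M i d -> M i c.
  move=> ai Mid; apply/negPn/negP => Mic.
  by have : d < c by [apply: (X_int (i := i)) => //; zlia]; zlia.
have [p [ap pc Mpc Mpc' dp]] : exists p, [/\ a <= p, p < c, ~~ M p c, M (p + 1) c &
    forall i, a <= i <= p -> ~~ M i d].
  suff H j : a <= j -> j <= c -> (exists p, [/\ a <= p, p < c, ~~ M p c, M (p + 1) c &
      forall i, a <= i <= p -> ~~ M i d]) \/ (forall i, a <= i <= j -> ~~ M i c).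
    have [//|nM] := H c (ltW ac) (lexx c).
    by have := nM c; rewrite M_diag => H'; have : false by apply: H'; zlia.
  move: j; apply: int_ind_from => [_|i ai IH ic].
    by right=> i ai; have -> : i = a by zlia.
  have [|//|nM] := IH; [zlia|by left|].
  have [Mi|Mi] := boolP (M (i + 1) c); [left|right].
    exists i; split=> //; [zlia|apply: nM; zlia|] => l li.
    by apply: contra (nM l li); apply: Mcd; zlia.
  move=> l li; have [->//|?] : l = i + 1 \/ l <= i by zlia.
  by apply: nM; zlia.
have Mpd : ~~ M (p + 1) d.
  have : ~~ M p d by apply: dp; zlia.
  by apply: contra => ?; apply: (M_new cd _ Mpc' Mpc) => //; zlia.
have negdp i : a <= i <= p + 1 -> neg i d.
  move=> ai; rewrite negd; have [->//|?] : i = p + 1 \/ i <= p by zlia.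
  by apply: dp; zlia.
have posc' i : p + 1 <= i <= c -> pos i c.
  by move=> pi; rewrite posc (persist _ _ _ Mpc') //; zlia.
have negd' i : a <= i <= p + 1 -> neg i (d - n).
  by move=> ai; rewrite -(neg_mul _ _ 1) mul1r subrK negdp.
have nega' : neg a (d - n) by apply: negd'; zlia.
have dw : d - n + k * n < w a.
  rewrite ltNge; apply/negP => dw.
  by apply: (gap a a (d - n)) => //; zlia.
have sgnd i : a < i <= p + 1 -> pos i d || neg i d.
  by move=> ai; rewrite negdp ?orbT //; zlia.
have wp1 := trackK a (p + 1) d k.
have wp2 := trackK a (p + 1) d (k - 1).
have {wp1} wp1 : (d + k * n < w a) = (d + k * n < w (p + 1)) by apply: wp1 => //; zlia.
have {wp2} : (d + (k - 1) * n < w a) = (d + (k - 1) * n < w (p + 1)) by apply: wp2 => //; zlia.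
rewrite mulrBl mul1r => wp2.
(* At time [p + 1] both [c] and [d] have a sign; beyond [c + k * n] the gap would see the negative
   [d] before the next copy of the positive [c]. *)
have cw : w (p + 1) <= c + k * n.
  rewrite leNgt; apply/negP => cw.
  apply: (@w_gap (p + 1) (c + k * n + n) (d + k * n)); try zlia.
  - by have := pos_mul (p + 1) c (k + 1); rewrite mulrDl mul1r addrA => ->; apply: posc'; zlia.
  - by rewrite neg_mul; apply: negdp; zlia.
have sgn i : p + 1 < i <= c -> pos i c || neg i c.
  by move=> pi; rewrite posc' //; zlia.
have := trackK (p + 1) c c k; have := trackK (p + 1) c c (k - 1).
rewrite mulrBl mul1r => /(_ _ _ ce sgn) h1 /(_ _ _ ce sgn) h2.
by move: h1 h2; zlia.
Qed.

Lemma ex_window x y : exists k, x + k * n < y /\ y <= x + k * n + n.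
Proof.
exists ((y - x - 1) %/ n)%Z; have := divz_eq (y - x - 1) n.
have := ltz_pmod (y - x - 1) n0; have := modz_ge0 (y - x - 1) (lt0r_neq0 n0).
by move: (divz _ _ * n); clear; lia.
Qed.

(** Two half turns, from [a] to [c] past [d] and from [c] to [a + n] past [b + n], move the window
    of the gap by exactly n. *)
Lemma full_turn a b c d k : t <= a -> a + n <= e ->
  a < b -> b < c -> c < d -> d < a + n ->
  X a -> ~~ Y a -> ~~ X b -> Y b -> X c -> ~~ Y c -> ~~ X d -> Y d ->
  (forall q, d - n <= q -> q < a -> X q -> Y q) ->
  (forall q, b <= q -> q < c -> X q -> Y q) ->
  a + k * n - n < w a -> w a <= a + k * n ->
  a + n + k * n - n < w (a + n) /\ w (a + n) <= a + n + k * n.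
Proof.
move=> ta ae ab bc cd da Xa Ya Xb Yb Xc Yc Xd Yd firsta firstc wa1 wa2.
have [||wc1 wc2] := half_turn ta _ _ cd da Ya Xc Yc Xd Yd firsta wa1 wa2; try zlia.
apply: (@half_turn c (a + n) (b + n)) => //; rewrite ?X_per ?Y_per //; try zlia.
by move=> q bq qc; apply: firstc; zlia.
Qed.

(* While [u] or [v] keeps its sign, the gap cannot cross it, and together they
   cover the whole period. *)
Lemma bad_turn s v u k : t <= s -> s + n <= e -> s < v -> v < u -> u < s + n ->
  M s u -> ~~ Y u -> ~~ M s v -> Y v ->
  v + k * n < w s -> w s <= v + k * n + n ->
  [/\ v + k * n < w (s + n), w (s + n) <= v + k * n + n &
      forall i, s <= i <= s + n -> v + k * n - n < w i /\ w i <= v + k * n + n].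
Proof.
move=> ts se sv vu us Mu Yu Mv Yv ws1 ws2.
have posu i : s <= i <= u -> pos i u.
  by move=> si; rewrite /pos Yu andbT; apply: (@persist s i) => //; zlia.
(* If [v] entered after time [v], it would persist until [s + n], hence belong to the necklace set
   of time [s]. *)
have negv i : v < i <= s + n -> neg i v.
  move=> vi; rewrite /neg Yv andbT; apply: contra Mv => Mv.
  by rewrite -M_pert -M_per; apply: (@persist i); rewrite ?M_per //; zlia.
have negs : neg s v by rewrite /neg Mv Yv.
have ws3 : w s <= u + k * n.
  rewrite leNgt; apply/negP => uw.
  apply: (@w_gap s (u + (k + 1) * n) (v + (k + 1) * n)); rewrite ?pos_mul ?neg_mul //.
  - by zlia.
  - by apply: posu; zlia.
  - by rewrite mulrDl mul1r; zlia.
  - by zlia.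
  - by rewrite mulrDl mul1r; zlia.
have wu i : s <= i -> i <= u -> u + k * n - n < w i /\ w i <= u + k * n.
  move=> si iu; have ie : i <= e by zlia.
  have sgn l j : s < j <= i -> pos j (u + l * n) || neg j (u + l * n).
    by move=> sj; rewrite pos_mul posu //; zlia.
  have := track ts si ie (sgn k); have := track ts si ie (sgn (k - 1)).
  by rewrite mulrBl mul1r; zlia.
have [wu1 wu2] : u + k * n - n < w u /\ w u <= u + k * n by apply: wu; zlia.
have wu3 : v + k * n < w u.
  rewrite ltNge; apply/negP => wv.
  apply: (@w_gap u (u + k * n) (v + k * n)); rewrite ?pos_mul ?neg_mul //.
  - by zlia.
  - by apply: posu; zlia.
  - by apply: negv; zlia.
  - by zlia.
  - by zlia.
have wv i : u <= i -> i <= s + n -> v + k * n < w i /\ w i <= v + k * n + n.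
  move=> ui isn; have ie : i <= e by zlia.
  have sgn l j : u < j <= i -> pos j (v + l * n) || neg j (v + l * n).
    by move=> sj; rewrite neg_mul negv ?orbT //; zlia.
  have tu : t <= u by zlia.
  have := track tu ui ie (sgn k); have := track tu ui ie (sgn (k + 1)).
  by rewrite mulrDl mul1r; zlia.
have [wsn1 wsn2] : v + k * n < w (s + n) /\ w (s + n) <= v + k * n + n by apply: wv; zlia.
split=> // i si; have [iu|ui] := leP i u.
  by have [] : u + k * n - n < w i /\ w i <= u + k * n; [apply: wu|]; zlia.
by have [] : v + k * n < w i /\ w i <= v + k * n + n; [apply: wv|]; zlia.
Qed.

(** Three full turns from [a] give w (a + 3n) - w a > 2n, whereas four bad turns from [t] keep both
    values in one window of length 2n. Four periods are used because [a] may lie anywhere in the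
    first. *)
Lemma winding_contra a b c d v u : t + 4 * n <= e -> t <= a -> a < t + n ->
  a < b -> b < c -> c < d -> d < a + n ->
  X a -> ~~ Y a -> ~~ X b -> Y b -> X c -> ~~ Y c -> ~~ X d -> Y d ->
  (forall q, d - n <= q -> q < a -> X q -> Y q) ->
  (forall q, b <= q -> q < c -> X q -> Y q) ->
  t < v -> v < u -> u < t + n -> M t u -> ~~ Y u -> ~~ M t v -> Y v -> False.
Proof.
move=> te ta at_ ab bc cd da Xa Ya Xb Yb Xc Yc Xd Yd firsta firstc tv vu ut Mu Yu Mv Yv.
have [k [wa1 wa2]] := ex_window (a - n) (w a).
have turn i l : t <= i -> i + n <= e -> i = a + l * n ->
    i + k * n - n < w i -> w i <= i + k * n ->
    i + n + k * n - n < w (i + n) /\ w (i + n) <= i + n + k * n.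
  move=> ti ie ia; apply: (@full_turn i (b + l * n) (c + l * n) (d + l * n)) => //;
    rewrite ?ia ?(per_mul X_per) ?(per_mul Y_per) //; try zlia.
  - move=> q dq qa; have := firsta (q + (- l) * n).
    by rewrite (per_mul X_per) (per_mul Y_per) mulNr; apply; zlia.
  - move=> q dq qa; have := firstc (q + (- l) * n).
    by rewrite (per_mul X_per) (per_mul Y_per) mulNr; apply; zlia.
have [|||||wa3 wa4] := turn a 0; try zlia.
have [|||||wa5 wa6] := turn (a + n) 1; try zlia.
have [|||||wa7 wa8] := turn (a + n + n) 2; try zlia.
have [l [wt1 wt2]] := ex_window v (w t).
have bad i (m : int) j : t <= i -> i + n <= e -> i = t + m * n ->
    v + l * n < w i -> w i <= v + l * n + n ->
    [/\ v + l * n < w (i + n), w (i + n) <= v + l * n + n &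
      i <= j <= i + n -> v + l * n - n < w j /\ w j <= v + l * n + n].
  move=> ti ie it wi1 wi2.
  have Mmul q : M i q = M t q by rewrite it (per_mul (f := M^~ q)).
  have := @bad_turn i (v + m * n) (u + m * n) (l - m).
  rewrite !(per_mul Y_per) !(per_mul (M_per _)) !Mmul mulrBl -addrA [m * n + _]addrC subrK.
  by case=> //; try zlia; move=> ? ? H; split=> // /H.
have [|||||wt3 wt4 wta] := bad t 0 a; try zlia.
have [|||||wt5 wt6 _] := bad (t + n) 1 a; try zlia.
have [|||||wt7 wt8 _] := bad (t + n + n) 2 a; try zlia.
have [|||||_ _ wtb] := bad (t + n + n + n) 3 (a + n + n + n); try zlia.
have [|? _] := wta; first zlia.
have [|_ ?] := wtb; first zlia.
zlia.
Qed.

End Winding.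

(** * Following a gap from one time to the next *)

Section Gaps.
Local Open Scope ring_scope.
Variable n : int.
Hypothesis n0 : 0 < n.

Definition gap (p q : int -> bool) (w : int) : Prop :=
  forall x y, p x -> q y -> w <= y -> y < x -> x < w + n -> False.

Lemma gap_mul (p q : int -> bool) w k :
  (forall x, p (x + n) = p x) -> (forall x, q (x + n) = q x) ->
  gap p q w -> gap p q (w + k * n).
Proof.
move=> pP qP gw x y px qy wy yx xw; apply: (gw (x + (- k) * n) (y + (- k) * n));
  by rewrite ?(per_mul pP) ?(per_mul qP) ?mulNr //; zlia.
Qed.

Lemma least_from (p : int -> bool) w : (forall x, p (x + n) = p x) -> (exists x, p x) ->
  exists x, [/\ p x, w <= x, x < w + n & forall y, p y -> w <= y -> x <= y].
Proof.
move=> pP [x0 px0]; have [k [k1 k2]] := ex_window n0 x0 (w + n).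
have ex : exists j : nat, p (w + j%:Z).
  exists (absz (x0 + k * n - w)%R); have -> : w + (absz (x0 + k * n - w)%R) = x0 + k * n by zlia.
  by rewrite (per_mul pP).
case: (ex_minnP ex) => j pj minj; have least y : p y -> w <= y -> w + j%:Z <= y.
  move=> py wy; have := minj (absz (y - w)%R).
  have -> : w + (absz (y - w)%R) = y by zlia.
  by move=> /(_ py); zlia.
exists (w + j%:Z); split=> //; first zlia.
by have := least (x0 + k * n); rewrite (per_mul pP) => /(_ px0); zlia.
Qed.

(** Around the cycle there is only one place where the last [q] is followed by the first [p], so two
    gaps of the same pair differ by a multiple of n, up to positions without sign. *)
Lemma gap_lift (p q : int -> bool) w g :
  (forall x, p (x + n) = p x) -> (forall x, q (x + n) = q x) ->
  (exists x, p x) -> (exists x, q x) -> gap p q w -> gap p q g ->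
  exists k, forall x, p x || q x -> (x < w) = (x < g + k * n).
Proof.
move=> pP qP exp exq gw gg.
have [a [pa wa aw mina]] := least_from w pP exp.
(* The last [q] before [w], obtained as the least one from [1 - w] on in the mirrored line. *)
have [||b' [qb wb bw minb]] := @least_from (fun x => q (- x)) (1 - w).
- by move=> x; rewrite -(qP (- (x + n))) opprD subrK.
- by case: exq => x qx; exists (- x); rewrite opprK.
move: qb wb bw minb; have [b -> ] : exists b, b' = - b by exists (- b'); rewrite opprK.
rewrite opprK => qb wb bw minb.
have {}minb x : q x -> x < w -> x <= b.
  by move=> qx xw; have := minb (- x); rewrite opprK => /(_ qx); zlia.
have [k [k1 k2]] : exists k, b < g + k * n /\ g + k * n <= b + n.
  by have [k [k1 k2]] := ex_window n0 g (b + n + 1); exists k; zlia.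
exists k; have {gg} := gap_mul (k := k) pP qP gg; move: (g + k * n) k1 k2 => h k1 k2 gh.
have qbn : q (b + n) by rewrite qP.
have ha : h <= a.
  rewrite leNgt; apply/negP => ah; apply: (gh (a + n) (b + n)); rewrite ?pP //; zlia.
move=> x /orP[px|qx]; apply/idP/idP => xw.
- rewrite ltNge; apply/negP => hx; apply: (gw (x + n) (b + n)); rewrite ?pP //; zlia.
- rewrite ltNge; apply/negP => wx; have := mina x px wx; zlia.
- by have := minb x qx xw; zlia.
- rewrite ltNge; apply/negP => wx; apply: (gw a x) => //; zlia.
Qed.

Variables (P Q p q : int -> int -> bool).
Hypothesis (P_per : forall i x, P i (x + n) = P i x).
Hypothesis (Q_per : forall i x, Q i (x + n) = Q i x).
Hypothesis (p_per : forall i x, p i (x + n) = p i x).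
Hypothesis (q_per : forall i x, q i (x + n) = q i x).
Hypothesis (pP : forall i x, p i x -> P i x) (pP1 : forall i x, p (i + 1) x -> P i x).
Hypothesis (qQ : forall i x, q i x -> Q i x) (qQ1 : forall i x, q (i + 1) x -> Q i x).
Hypothesis (p_ex : forall i, exists x, p i x) (q_ex : forall i, exists x, q i x).
Hypothesis (PQ_gap : forall i, exists w, gap (P i) (Q i) w).

(** [P i] and [Q i] contain the signs of times i and i + 1. So the gaps chosen at i and at i + 1 are
    both gaps for the signs of time i + 1, and a multiple of n makes the new one continue the old
    one. *)
Lemma ex_path t (m : nat) : exists w : int -> int,
  (forall i, t <= i <= t + m%:Z -> gap (P i) (Q i) (w i)) /\
  (forall i, t <= i -> i < t + m%:Z -> forall x, p (i + 1) x || q (i + 1) x ->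
     (x < w i) = (x < w (i + 1))).
Proof.
elim: m => [|m [w [gw sw]]].
  have [g gP] := PQ_gap t; exists (fun=> g); split=> [i ti|i ti it]; last by zlia.
  by have -> : i = t by zlia.
pose s := t + m%:Z; have [g gP] := PQ_gap (s + 1).
have gs : gap (P s) (Q s) (w s) by apply: gw; rewrite /s; zlia.
have [||||||k kP] := @gap_lift (p (s + 1)) (q (s + 1)) (w s) g; rewrite -?/s; auto.
- by move=> x y px qy; apply: gs; auto.
- by move=> x y px qy; apply: gP; auto.
exists (fun i => if i <= s then w i else g + k * n); split=> [i ti|i ti it].
  case: leP => [si|si]; first by apply: gw; rewrite -/s; zlia.
  have -> : i = s + 1 by rewrite /s in si *; zlia.
  exact: gap_mul.
move=> x sx; have is_ : i <= s by rewrite /s; zlia.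
rewrite is_; have [lt|eq] : i < s \/ i = s by rewrite /s in is_ *; zlia.
  have -> : i + 1 <= s by zlia.
  by apply: sw.
have -> : (i + 1 <= s) = false by zlia.
by rewrite eq; apply: kP; rewrite -eq.
Qed.

End Gaps.

(** * Alternating quadruples and two consecutive necklace sets *)

Definition cyc4 (a b c d : nat) : bool :=
  [|| (a < b < c) && (c < d), (b < c < d) && (d < a), (c < d < a) && (a < b) |
      (d < a < b) && (b < c)].

Lemma wsep_cyc4 n (P Q : {set 'I_n}) (p q p' q' : 'I_n) : wsep P Q ->
  p \in P :\: Q -> q \in Q :\: P -> p' \in P :\: Q -> q' \in Q :\: P ->
  ~~ cyc4 p q p' q'.
Proof.
move=> /existsP[j /cyc_llP ll]; rewrite !inE => /andP[pQ pP] /andP[qP qQ] /andP[pQ' pP'].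
move=> /andP[qP' qQ']; have := ll p q pP pQ qQ qP; have := ll p q' pP pQ qQ' qP'.
have := ll p' q pP' pQ' qQ qP; have := ll p' q' pP' pQ' qQ' qP'.
by rewrite !cyc_ltE /cyc4; clear; lia.
Qed.

(** Each of the two failures of surrounding encloses a point of one difference between two points of
    the other; comparing the two enclosed points selects the quadruple. *)
Lemma wsepN_cyc4 n (P Q : {set 'I_n}) : 0 < n -> ~~ wsep P Q ->
  exists p q p' q', [/\ p \in P :\: Q, q \in Q :\: P, p' \in P :\: Q, q' \in Q :\: P &
    cyc4 p q p' q'].
Proof.
move=> n0; rewrite wsep_surr // negb_or => /andP[/(surrN (@ord_inj n)) + /(surrN (@ord_inj n))].
move=> [b [a [b' /and5P[aP aQ bQ bP /and3P[bQ' bP' /andP[ba ab]]]]]].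
move=> [x [y [x' /and5P[yQ yP xP xQ /and3P[xP' xQ' /andP[xy yx]]]]]].
have : (y != a :> nat) by apply: contraNneq aQ => /ord_inj <-.
case: ltngtP => // ya _.
  by exists x, y, a, b'; split; rewrite ?inE ?xP ?xQ ?yQ ?yP ?aP ?aQ ?bQ' ?bP' // /cyc4 xy ya ab.
exists a, y, x', b; split; rewrite ?inE ?xP' ?xQ' ?yQ ?yP ?aP ?aQ ?bQ ?bP //.
by rewrite /cyc4 ba ya yx !orbT.
Qed.

Lemma exchange_uniq (T : finType) (A A' : {set T}) i x y : #|A'| = #|A| ->
  A :\ i \subset A' -> x \in A' -> x \notin A -> y \in A' -> y \notin A -> x = y.
Proof.
move=> cA /subsetP sA xA' xA yA' yA; apply/eqP/negPn/negP => xy.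
have le : #|A' :\: [set x; y]|.+2 <= #|A :\ i|.+1.
  have : #|A| <= #|A :\ i|.+1 by rewrite [#|A|](cardsD1 i); case: (i \in A).
  rewrite -cA -(cardsID [set x; y] A').
  suff -> : A' :&: [set x; y] = [set x; y] by rewrite cards2 xy.
  by apply/setIidPr; rewrite subUset !sub1set xA'.
have [|z /andP[]] := @card_exD _ (A' :\: [set x; y]) (A :\ i); first lia.
move=> /[dup] /sA zA' /setD1P[_ zA]; rewrite !inE zA' andbT negbK.
by case/orP => /eqP e; [move: xA|move: yA]; rewrite -e zA.
Qed.

(** The two sets compared are disjoint and collect the signs at both times, so their separation is a
    gap common to both. An alternating quadruple is excluded because at most [i] leaves and at most
    one element enters. *)
Lemma wsep_step n (A A' Y : {set 'I_n}) i : 0 < n -> #|A| = #|Y| -> #|A'| = #|Y| ->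
  A :\ i \subset A' -> wsep A Y -> wsep A' Y ->
  wsep ((A :|: A') :\: Y) (Y :\: (A :&: A')).
Proof.
move=> n0 cA cA' /subsetP sA wA wA'.
have old x : x \in A -> x \notin A' -> x = i.
  by move=> xA; apply: contraNeq => xi; apply: sA; rewrite !inE xi.
have new x y := @exchange_uniq _ A A' i x y (etrans cA' (esym cA)) (introT subsetP sA).
have noA p q p' q' : p \in A :\: Y -> q \in Y :\: A -> p' \in A :\: Y -> q' \in Y :\: A ->
    cyc4 p q p' q' -> False by move=> hp hq hp' hq'; apply/negP/(wsep_cyc4 wA).
have noA' p q p' q' : p \in A' :\: Y -> q \in Y :\: A' -> p' \in A' :\: Y -> q' \in Y :\: A' ->
    cyc4 p q p' q' -> False by move=> hp hq hp' hq'; apply/negP/(wsep_cyc4 wA').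
have rot p q p' q' : cyc4 p q p' q' -> cyc4 p' q' p q by rewrite /cyc4; clear; lia.
(* Counting gives a [z] other than [i] in [A] outside [Y]. It also lies in [A'], so it can replace
   [p] or [p'] and bring the quadruple into a single time. [both_neg] is the dual. *)
have both_pos p q p' q' : p \in A -> p \notin A' -> p \notin Y -> p' \in A' -> p' \notin A ->
    p' \notin Y -> q \in Y -> q \notin A -> q \notin A' -> q' \in Y -> q' \notin A ->
    q' \notin A' -> cyc4 p q p' q' -> False.
  move=> pA pA' pY p'A' p'A p'Y qY qA qA' q'Y q'A q'A' c4.
  have leY : #|Y| <= #|A :\ i|.+1 by rewrite -cA [#|A|](cardsD1 i); case: (i \in A).
  have [|||z /andP[/setD1P[zi zA] zY]] := card_exDxx leY qY _ q'Y.
  - by rewrite !inE (negbTE qA) andbF.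
  - by rewrite !inE (negbTE q'A) andbF.
  - by apply: contraTneq c4 => ->; rewrite /cyc4; clear; lia.
  have zA' : z \in A' by apply/negPn/negP => /(old z zA)/eqP; rewrite (negbTE zi).
  have zq : (z != q :> nat) by apply: contraNneq zY => /ord_inj->.
  have zq' : (z != q' :> nat) by apply: contraNneq zY => /ord_inj->.
  have : cyc4 p q z q' || cyc4 z q p' q' by move: c4 zq zq'; rewrite /cyc4; clear; lia.
  by case/orP => [/noA|/noA']; rewrite !inE; mem_known; rewrite !andbT; apply.
have both_neg p q p' q' : q \in A -> q \notin A' -> q \in Y -> q' \in A' -> q' \notin A ->
    q' \in Y -> p \notin Y -> p \in A -> p \in A' -> p' \notin Y -> p' \in A ->
    p' \in A' -> cyc4 p q p' q' -> False.
  move=> qA qA' qY q'A' q'A q'Y pY pA pA' p'Y p'A p'A' c4.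
  have leY : #|A'| <= #|Y :\ i|.+1 by rewrite cA' [#|Y|](cardsD1 i); case: (i \in Y).
  have [|||z /andP[/setD1P[zi zY] zA']] := card_exDxx leY pA' _ p'A'.
  - by rewrite !inE (negbTE pY) andbF.
  - by rewrite !inE (negbTE p'Y) andbF.
  - by apply: contraTneq c4 => ->; rewrite /cyc4; clear; lia.
  have zA : z \notin A by apply/negP => /old/(_ zA')/eqP; rewrite (negbTE zi).
  have zp : (z != p :> nat) by apply: contraNneq zA => /ord_inj->.
  have zp' : (z != p' :> nat) by apply: contraNneq zA => /ord_inj->.
  have : cyc4 p q p' z || cyc4 p z p' q' by move: c4 zp zp'; rewrite /cyc4; clear; lia.
  by case/orP => [/noA'|/noA]; rewrite !inE; mem_known; rewrite !andbT; apply.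
case: (boolP (wsep _ _)) => // /(wsepN_cyc4 n0)[p [q [p' [q' [hp hq hp' hq' c4]]]]].
exfalso; have sep x y : x \notin Y -> y \in Y ->
    ~~ [&& x \in A, x \notin A', y \in A & y \notin A'] &&
    ~~ [&& x \in A', x \notin A, y \in A' & y \notin A].
  move=> xY yY; have xy : x != y by apply: contraNneq xY => ->.
  apply/andP; split; apply: contra xy => /and4P[xA xA' yA yA'].
    by rewrite (old x xA xA') (old y yA yA').
  by apply/eqP/new.
move: hp hq hp' hq' => /setDP[+ _] /setDP[+ _] /setDP[+ _] /setDP[+ _].
rewrite !inE => /andP[pY pU] /andP[qI qY] /andP[pY' pU'] /andP[qI' qY'].
have eA : [&& p \in A, p' \in A, q \notin A & q' \notin A] ==> false.
  apply/implyP => /and4P[pA p'A qA q'A].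
  by exfalso; apply: (noA p q p' q') => //; rewrite !inE ?pY ?pY' ?pA ?p'A ?qA ?q'A ?qY ?qY'.
have eA' : [&& p \in A', p' \in A', q \notin A' & q' \notin A'] ==> false.
  apply/implyP => /and4P[pA p'A qA q'A].
  by exfalso; apply: (noA' p q p' q') => //; rewrite !inE ?pY ?pY' ?pA ?p'A ?qA ?q'A ?qY ?qY'.
have ep a b a' b' : a \notin Y -> b \in Y -> a' \notin Y -> b' \in Y -> cyc4 a b a' b' ->
    [&& a \in A, a \notin A', a' \in A', a' \notin A,
        b \notin A, b \notin A', b' \notin A & b' \notin A'] ==> false.
  move=> aY bY a'Y b'Y c; apply/implyP => /and5P[h1 h2 h3 h4 /and4P[h5 h6 h7 h8]].
  by exfalso; apply: (both_pos a b a' b').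
have en a b a' b' : a \notin Y -> b \in Y -> a' \notin Y -> b' \in Y -> cyc4 a b a' b' ->
    [&& b \in A, b \notin A', b' \in A', b' \notin A,
        a \in A, a \in A', a' \in A & a' \in A'] ==> false.
  move=> aY bY a'Y b'Y c; apply/implyP => /and5P[h1 h2 h3 h4 /and4P[h5 h6 h7 h8]].
  by exfalso; apply: (both_neg a b a' b').
have c4' := rot _ _ _ _ c4.
(* Only the eight memberships of the four points in [A] and [A'] remain, a finite check. *)
move: pU qI pU' qI' eA eA' (sep p q pY qY) (sep p q' pY qY') (sep p' q pY' qY)
  (sep p' q' pY' qY') (ep _ _ _ _ pY qY pY' qY' c4) (ep _ _ _ _ pY' qY' pY qY c4')
  (en _ _ _ _ pY qY pY' qY' c4) (en _ _ _ _ pY' qY' pY qY c4').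
move: (p \in A) (p \in A') (q \in A) (q \in A') (p' \in A) (p' \in A') (q' \in A) (q' \in A').
by clear; do 8 case.
Qed.

(** * Interior against exterior *)

Section Residue.
Variables (n : nat) (n0 : 0 < n).
Local Open Scope ring_scope.

Lemma residue_subproof (q : int) : (`|(q %% n%:Z)%Z| < n)%N.
Proof.
have n0' : 0 < n%:Z by lia.
have := ltz_pmod q n0'; have := modz_ge0 q (lt0r_neq0 n0'); lia.
Qed.

Definition residue (q : int) : 'I_n := Ordinal (residue_subproof q).

Lemma residueE q : exists k, q = k * n%:Z + (residue q : nat)%:Z.
Proof.
exists (q %/ n%:Z)%Z; rewrite {1}(divz_eq q n%:Z) /= gez0_abs //.
by apply: modz_ge0; lia.
Qed.

Lemma residue_uniq q k (x : 'I_n) : q = k * n%:Z + (x : nat)%:Z -> residue q = x.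
Proof.
move=> ->; apply: ord_inj => /=; rewrite modzMDl modz_small ?absz_nat //.
by have := ltn_ord x; lia.
Qed.

Lemma residue_ord (x : 'I_n) : residue (x : nat)%:Z = x.
Proof. by apply: (residue_uniq (k := 0)); rewrite mul0r add0r. Qed.

Lemma residue_per q : residue (q + n%:Z) = residue q.
Proof.
have [k e] := residueE q; apply: (residue_uniq (k := k + 1)); rewrite {1}e.
by rewrite mulrDl mul1r addrAC.
Qed.

Lemma residueS q : residue (q + 1) = ordS (residue q).
Proof.
have [k e] := residueE q; apply: ord_inj; rewrite /= {1}e -addrA modzMDl.
by rewrite -[1]/(1%:Z) -PoszD modz_nat absz_nat addn1.
Qed.

Lemma residue_lift (x : 'I_n) s : exists q, [/\ s <= q, q < s + n%:Z & residue q = x].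
Proof.
have n0' : 0 < n%:Z by lia.
have [k [k1 k2]] := ex_window n0' (x : nat)%:Z (s + n%:Z).
exists ((x : nat)%:Z + k * n%:Z); split; [lia|lia|].
by apply: (residue_uniq (k := k)); rewrite addrC.
Qed.

Lemma cyc_lt_residue i p q : i <= p -> p < i + n%:Z -> i <= q -> q < i + n%:Z ->
  cyc_lt (residue i) (residue p) (residue q) = (p < q).
Proof.
have off s : i <= s -> s < i + n%:Z ->
    ((residue s + (n - residue i)) %% n)%N%:Z = s - i :> int.
  move=> is_ sn; rewrite rot_modE.
  have [k ek] := residueE s; have [l el] := residueE i.
  have := ltn_ord (residue s); have := ltn_ord (residue i).
  move: (nat_of_ord (residue s)) (nat_of_ord (residue i)) ek el => a b ek el bn an.
  have n0' : 0 < n%:Z by lia.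
  have kl : (- 1 < k - l) && (k - l < 2).
    rewrite -(ltr_pM2r n0' (- 1)) -(ltr_pM2r n0' _ 2) mulrBl; lia.
  have [e|e] : k = l \/ k = l + 1 by lia.
    by rewrite e in ek; case: (leqP b a) => ab; lia.
  by rewrite e mulrDl in ek; case: (leqP b a) => ab; lia.
move=> ip pn iq qn; rewrite /cyc_lt -ltz_nat !off //; lia.
Qed.

Lemma residue_eq p q : residue p = residue q -> p <= q -> q < p + n%:Z -> p = q.
Proof.
move=> e pq qn; have := cyc_lt_residue (lexx p) _ pq qn; rewrite e /cyc_lt ltnn.
by move=> /(_ _)/esym; lia.
Qed.

End Residue.

Lemma necklace_step n r (N : 'I_n -> {set 'I_n}) (n0 : 0 < n) (s x : int) :
  necklace r N -> (s < x)%R -> (x < s + n%:Z)%R ->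
  residue n0 x \in N (residue n0 s) -> residue n0 x \in N (residue n0 (s + 1)%R).
Proof.
move=> [_ sN] sx xs Mx; rewrite residueS; apply: (subsetP (sN _)).
apply/setD1P; split=> //; apply/eqP => /esym e.
have := residue_eq e (ltW sx) xs; zlia.
Qed.

Lemma int_out_wsep n r (N : 'I_n -> {set 'I_n}) (X Y : {set 'I_n}) : 0 < n ->
  necklace r N -> (forall i, i \in N i) -> X \in Int r N -> Y \in Out r N -> wsep X Y.
Proof.
move=> n0 neck std /[!inE] /andP[/eqP cX /forallP intX]; have [cN sN] := neck.
move=> /andP[+ /andP[/eqP cY /forallP sepY]]; rewrite cY eqxx /= negb_forall.
move=> /existsP[i0 nll]; case: (boolP (wsep X Y)) => // nXY; exfalso.
(* Together with equal sizes, this provides positive and negative elements at every time, without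
   which a gap would not be determined. *)
have NY i : N i != Y.
  by apply: contraNneq nXY => <-; rewrite wsepC //; apply/existsP; exists i.
have [u [v [uN uY vY vN uv]]] : exists u v,
    [/\ u \in N i0, u \notin Y, v \in Y, v \notin N i0 & ~~ cyc_lt i0 u v].
  move: nll => /forall_inPn[u /setDP[uN uY] /forall_inPn[v /setDP[vY vN] uv]].
  by exists u, v.
have [p [q [p' [q' [hp hq hp' hq' c4]]]]] := wsepN_cyc4 n0 nXY.
pose rho := residue n0; pose M i x := rho x \in N (rho i).
pose XX x := rho x \in X; pose YY x := rho x \in Y.
have rhoP x : rho (x + n%:Z)%R = rho x by apply: residue_per.
have MP i x : M i (x + n%:Z)%R = M i x by rewrite /M rhoP.
have MT i x : M (i + n%:Z)%R x = M i x by rewrite /M rhoP.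
have XP x : XX (x + n%:Z)%R = XX x by rewrite /XX rhoP.
have YP x : YY (x + n%:Z)%R = YY x by rewrite /YY rhoP.
have new i x y : x \in N (ordS i) -> x \notin N i -> y \in N (ordS i) -> y \notin N i -> x = y.
  by apply: exchange_uniq (sN i); rewrite !cN.
have Mstep i x : (i < x)%R -> (x < i + n%:Z)%R -> M i x -> M (i + 1)%R x.
  exact: necklace_step neck.
have Mnew i c d : (c < d)%R -> (d < c + n%:Z)%R -> M (i + 1)%R c -> ~~ M i c ->
    M (i + 1)%R d -> M i d.
  rewrite /M /rho residueS => cd dc cN1 cN0 dN1; apply/negPn/negP => dN0.
  have := residue_eq (new _ _ _ cN1 cN0 dN1 dN0) (ltW cd) dc; zlia.
have Mcard i x : M i x -> ~~ XX x -> exists2 y, (i <= y < i + n%:Z)%R & XX y && ~~ M i y.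
  move=> Mx Xx; have [|z zP] := card_exDx _ Mx Xx; first by rewrite cN cX.
  by have [y [iy yi ey]] := residue_lift n0 z i; exists y; rewrite /XX /M /rho ?ey // iy yi.
have Xint i x y : (i <= x < i + n%:Z)%R -> (i <= y < i + n%:Z)%R ->
    M i x -> ~~ XX x -> XX y -> ~~ M i y -> (x < y)%R.
  move=> /andP[ix xi] /andP[iy yi] Mx Xx Xy My; rewrite -(@cyc_lt_residue _ n0 i) //.
  by move/cyc_llP: (intX (rho i)); apply.
pose P i x := (M i x || M (i + 1)%R x) && ~~ YY x.
pose Q i x := YY x && ~~ (M i x && M (i + 1)%R x).
have sg i : exists w, gap n%:Z%R (P i) (Q i) w.
  have wNY j : wsep (N j) Y by rewrite wsepC.
  have cNY j : #|N j| = #|Y| by rewrite cN cY.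
  have /existsP[j /cyc_llP ll] :=
    wsep_step n0 (cNY _) (cNY _) (sN (rho i)) (wNY _) (wNY _).
  exists (nat_of_ord j)%:Z%R => x y; rewrite /P /Q /M /rho residueS => Px Qy wy yx xw.
  have Px' : rho x \in (N (rho i) :|: N (ordS (rho i))) :\: Y.
    by rewrite in_setD in_setU andbC.
  have Qy' : rho y \in Y :\: (N (rho i) :&: N (ordS (rho i))).
    by rewrite in_setD in_setI andbC.
  have dis z A B : z \in A :\: Y -> z \notin Y :\: B.
    by rewrite !inE => /andP[/negbTE-> _]; rewrite andbF.
  have dis' z A B : z \in Y :\: B -> z \notin A :\: Y by rewrite !inE => /andP[_ ->].
  have := ll _ _ Px' (dis _ _ _ Px') Qy' (dis' _ _ _ Qy').
  rewrite -(residue_ord n0 j) cyc_lt_residue; zlia.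
have pex i : exists x, pos M YY i x.
  have [z /setDP[zN zY]] : exists z, z \in N (rho i) :\: Y.
    apply/set0Pn; rewrite setD_eq0; apply: contra (NY (rho i)) => sub.
    by rewrite eqEcard sub cN cY leqnn.
  have [x [_ _ ex]] := residue_lift n0 z 0.
  by exists x; rewrite /pos /M /YY /rho ex zN.
have qex i : exists x, neg M YY i x.
  have [z /setDP[zY zN]] : exists z, z \in Y :\: N (rho i).
    apply/set0Pn; rewrite setD_eq0; apply: contra (NY (rho i)) => sub.
    by rewrite eq_sym eqEcard sub cN cY leqnn.
  have [x [_ _ ex]] := residue_lift n0 z 0.
  by exists x; rewrite /neg /M /YY /rho ex zN.
have Pper i x : P i (x + n%:Z)%R = P i x by rewrite /P !MP YP.
have Qper i x : Q i (x + n%:Z)%R = Q i x by rewrite /Q !MP YP.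
have c4E : [&& p != q, cyc_lt p q p' & cyc_lt p p' q'].
  have -> : p != q by apply: contraTneq c4 => ->; rewrite /cyc4; clear; lia.
  by rewrite !cyc_ltE; move: c4; rewrite /cyc4; clear; lia.
move: c4E => /and3P[pq cyc1 cyc2].
have [a0 [_ _ ea]] := residue_lift n0 p 0.
have [b [ab0 ba0 eb]] := residue_lift n0 q a0.
have [c0 [ac0 ca0 ec]] := residue_lift n0 p' a0.
have [d [ad0 da0 ed]] := residue_lift n0 q' a0.
have ltab : (a0 < b)%R.
  by rewrite lt_neqAle ab0 andbT; apply: contra pq => /eqP eab; rewrite -ea -eb eab.
have ltbc : (b < c0)%R by rewrite -(@cyc_lt_residue _ n0 a0) ?ea ?eb ?ec //; zlia.
have ltcd : (c0 < d)%R by rewrite -(@cyc_lt_residue _ n0 a0) ?ea ?ec ?ed //; zlia.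
pose D x := XX x && ~~ YY x.
have DP x : D (x + n%:Z)%R = D x by rewrite /D XP YP.
have Da0 : D a0 by rewrite /D /XX /YY /rho ea andbC -in_setD.
have Dc0 : D c0 by rewrite /D /XX /YY /rho ec andbC -in_setD.
have Db : ~~ XX b && YY b by rewrite /XX /YY /rho eb -in_setD.
have Dd : ~~ XX d && YY d by rewrite /XX /YY /rho ed -in_setD.
have n0' : (0 < n%:Z)%R by rewrite ltz_nat.
have exD : exists x, D x by exists a0.
(* The alternating quadruple is normalized: [a] and [c] become the first elements of [X :\: Y] after
   [d - n] and after [b], as the half turns require. *)
have [a [Da da _ mina]] := least_from n0' (d - n%:Z)%R DP exD.
have [c [Dc bc _ minc]] := least_from n0' b DP exD.
have leaa : (a <= a0)%R by apply: mina => //; zlia.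
have lecc : (c <= c0)%R by apply: minc => //; zlia.
(* This representative of [i0] satisfies t <= a < t + n. *)
have [t [at1 at2 et]] := residue_lift n0 i0 (a - n%:Z + 1)%R.
have [u' [tu ut eu]] := residue_lift n0 u t.
have [v' [tv vt ev]] := residue_lift n0 v t.
have uv' : (v' < u')%R.
  move: uv; rewrite -et -eu -ev cyc_lt_residue // -leNgt le_eqVlt => /predU1P[e|//].
  by move: vY; rewrite -ev e eu (negbTE uY).
(* Strict because [i0] belongs to [N i0] and [v] does not. *)
have ltv : (t < v')%R.
  rewrite lt_neqAle tv andbT; apply: contra vN => /eqP e.
  by rewrite -ev -e et std.
have [w [gw sw]] : exists w : int -> int,
    (forall i, (t <= i <= t + (4 * n)%N%:Z)%R -> gap n%:Z%R (P i) (Q i) (w i)) /\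
    (forall i, (t <= i)%R -> (i < t + (4 * n)%N%:Z)%R -> forall x,
       pos M YY (i + 1)%R x || neg M YY (i + 1)%R x -> (x < w i)%R = (x < w (i + 1))%R).
  apply: ex_path => //.
  - by move=> i x; rewrite /pos MP YP.
  - by move=> i x; rewrite /neg MP YP.
  - by move=> i x /andP[Mx Yx]; rewrite /P Mx Yx.
  - by move=> i x /andP[Mx Yx]; rewrite /P Mx Yx orbT.
  - by move=> i x /andP[/negbTE Mx Yx]; rewrite /Q Mx Yx.
  - by move=> i x /andP[/negbTE Mx Yx]; rewrite /Q Mx Yx andbF.
case/andP: Da => Xa Ya; case/andP: Dc => Xc Yc.
case/andP: Db => Xb Yb; case/andP: Dd => Xd Yd.
have gapw i x y : (t <= i <= t + (4 * n)%N%:Z)%R -> pos M YY i x -> neg M YY i y ->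
    (w i <= y)%R -> (y < x)%R -> (x < w i + n%:Z)%R -> False.
  move=> ti /andP[Mx Yx] /andP[/negbTE My Yy]; apply: gw => //.
    by rewrite /P Mx Yx.
  by rewrite /Q My Yy.
have Mdiag i : M i i by apply: std.
have H := (@winding_contra n%:Z%R M XX YY w t _ n0' MP MT XP YP Mdiag Mstep Mnew Mcard Xint gapw
  (fun i x ti it => sw i ti it x) a b c d v' u').
apply: H => //.
- by zlia.
- by zlia.
- by zlia.
- rewrite lt_neqAle bc andbT; apply: contraTneq Xc => <-; exact: Xb.
- by zlia.
- have : (d - n%:Z)%R != a by apply: contraTneq Xa => <-; rewrite -XP subrK.
  by move: da; clear; lia.
- move=> x dx xa Xx; apply/negPn/negP => Yx; have := mina x; rewrite /D Xx Yx => /(_ isT dx).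
  zlia.
- move=> x dx xa Xx; apply/negPn/negP => Yx; have := minc x; rewrite /D Xx Yx => /(_ isT dx).
  zlia.
- by rewrite /M /rho et eu.
- by rewrite /YY /rho eu.
- by rewrite /M /rho et ev.
- by rewrite /YY /rho ev.
Qed.

(** Read from [j], an element lost between times [j] and [i] lies before [i] by persistence. One of
    [N i] lying before [i] would persist through the end of the period, hence belong to [N j]. *)
Lemma necklace_int n r (N : 'I_n -> {set 'I_n}) i : 0 < n ->
  necklace r N -> (forall j, j \in N j) -> N i \in Int r N.
Proof.
move=> n0 neck std; rewrite inE neck.1 eqxx; apply/forallP => j.
pose M s x := residue n0 x \in N (residue n0 s).
have Mstep s x : (s < x)%R -> (x < s + n%:Z)%R -> M s x -> M (s + 1)%R x.
  exact: necklace_step neck.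
have n0' : (0 < n%:Z)%R by rewrite ltz_nat.
have [s [_ _ es]] := residue_lift n0 j 0.
have [t [st ts et]] := residue_lift n0 i s.
apply/cyc_llP => u v uN uN' vN vN'.
have [x [sx xs ex]] := residue_lift n0 u s.
have [y [sy ys ey]] := residue_lift n0 v s.
rewrite -es -ex -ey cyc_lt_residue //.
have xt : (x < t)%R.
  rewrite ltNge; apply: contra uN' => tx; rewrite -et -ex.
  by have := persist n0' Mstep st tx xs; rewrite /M es ex; apply.
have ty : (t <= y)%R.
  rewrite leNgt; apply: contra vN' => yt; rewrite -ey -(residue_per n0 y) -es -(residue_per n0 s).
  have := @persist _ _ n0' Mstep t (s + n%:Z)%R (y + n%:Z)%R.
  by rewrite /M !residue_per et ey; apply=> //; zlia.
zlia.
Qed.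

(** * Assembling maximal systems and the rank formula *)

Lemma wsepxx n (X : {set 'I_n}) : 0 < n -> wsep X X.
Proof. by move=> n0; apply/existsP; exists (Ordinal n0); apply/cyc_llP => x y ->. Qed.

Lemma max_separatedP n (D S : {set {set 'I_n}}) : 0 < n ->
  reflect [/\ S \subset D, {in S &, forall X Y, wsep X Y} &
             forall X, X \in D -> {in S, forall Y, wsep X Y} -> X \in S]
          (max_separated D S).
Proof.
move=> n0.
have sepP (W : {set {set 'I_n}}) : reflect {in W &, forall X Y, wsep X Y} (separated W).
  apply: (iffP forall_inP) => wW X; last by move=> XW; apply/forall_inP => Y; apply: wW.
  by move=> Y XW; move/forall_inP: (wW X XW); apply.
apply: (iffP maxsetP) => [[/andP[sS /sepP wS] mS]|[sS wS mS]]; split=> //.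
- move=> X XD wX; rewrite -(mS (X |: S)) ?setU11 ?subsetUr //.
  rewrite subUset sub1set XD sS; apply/sepP => Y Z /setU1P[->|YS] /setU1P[->|ZS].
  + exact: wsepxx.
  + exact: wX.
  + by rewrite wsepC // wX.
  + exact: wS.
- by rewrite sS; apply/sepP.
move=> W /andP[/subsetP sW /sepP wW] sSW; apply/eqP; rewrite eqEsubset sSW andbT.
apply/subsetP => X XW; apply: mS => [|Y YS]; first exact: sW.
by apply: wW => //; apply: (subsetP sSW).
Qed.

Lemma int_wsep n r (N : 'I_n -> {set 'I_n}) X i : X \in Int r N -> wsep (N i) X.
Proof. by rewrite inE => /andP[_ /forallP ll]; apply/existsP; exists i. Qed.

Lemma max_separated_union n r (N1 N2 : 'I_n -> {set 'I_n}) (A S B : {set {set 'I_n}}) :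
  0 < n -> necklace r N1 -> necklace r N2 ->
  (forall i, i \in N1 i) -> (forall i, i \in N2 i) -> necklace_le r N1 N2 ->
  max_separated (Int r N1) A -> max_separated (Int r N2 :&: Out r N1) S ->
  max_separated (Out r N2) B ->
  max_separated (ksets n r) (A :|: S :|: B) /\ #|A :|: S :|: B| = #|A| + #|S| + #|B|.
Proof.
move=> n0 neck1 neck2 std1 std2 /subsetP le12.
move=> /(max_separatedP _ _ n0)[/subsetP sA wA mA] /(max_separatedP _ _ n0)[/subsetP sS wS mS].
move=> /(max_separatedP _ _ n0)[/subsetP sB wB mB].
have sA2 X : X \in A -> X \in Int r N2 by move=> /sA/le12.
have sS1 X : X \in S -> X \in Out r N1 by move=> /sS/setIP[].
have sS2 X : X \in S -> X \in Int r N2 by move=> /sS/setIP[].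
have wAS X Y : X \in A -> Y \in S -> wsep X Y.
  by move=> /sA XI /sS1; apply: int_out_wsep XI.
have wAB X Y : X \in A -> Y \in B -> wsep X Y.
  by move=> /sA2 XI /sB; apply: int_out_wsep XI.
have wSB X Y : X \in S -> Y \in B -> wsep X Y.
  by move=> /sS2 XI /sB; apply: int_out_wsep XI.
have N1A i : N1 i \in A.
  by apply: mA => [|Y /sA]; [apply: necklace_int|apply: int_wsep].
(* If [N2 i] is outside the interior of [N1], it is in the exterior: the sets [N1 j] lie in the
   interior of [N2] and so are separated from it. *)
have N2AS i : N2 i \in A :|: S.
  have N2I : N2 i \in Int r N2 by apply: necklace_int.
  apply/setUP; have [N2I1|N2nI1] := boolP (N2 i \in Int r N1); [left|right].
    by apply: mA => // Y /sA2; apply: int_wsep.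
  apply: mS => [|Y /sS2]; last exact: int_wsep.
  rewrite inE N2I inE N2nI1 inE; case: neck2 => cN2 _; rewrite cN2 eqxx.
  by apply/forallP => j; apply: int_wsep (sA2 _ (N1A j)).
split.
  apply/max_separatedP => //; split.
  - have card_int N X : X \in Int r N -> X \in ksets n r by rewrite !inE => /andP[].
    apply/subsetP => X; rewrite in_setU in_setU -orbA => /or3P[/sA|/sS2|/sB]; try exact: card_int.
    by rewrite !inE => /andP[_ /andP[]].
  - move=> X Y; rewrite !in_setU -!orbA => /or3P[]hX /or3P[]hY.
    + exact: wA.
    + exact: wAS.
    + exact: wAB.
    + by rewrite wsepC // wAS.
    + exact: wS.
    + exact: wSB.
    + by rewrite wsepC // wAB.
    + by rewrite wsepC // wSB.
    + exact: wB.
  move=> X; rewrite inE => cX wX.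
  have wXA Y : Y \in A -> wsep X Y by move=> YA; apply: wX; rewrite !inE YA.
  have wXS Y : Y \in S -> wsep X Y by move=> YS; apply: wX; rewrite !inE YS orbT.
  have wXB Y : Y \in B -> wsep X Y by move=> YB; apply: wX; rewrite !inE YB !orbT.
  rewrite !in_setU -orbA; apply/or3P.
  have [XI1|XI1] := boolP (X \in Int r N1); first by apply: Or31; apply: mA.
  have XO1 : X \in Out r N1.
    by rewrite inE XI1 inE cX; apply/forallP => i; exact: wXA (N1A i).
  have [XI2|XI2] := boolP (X \in Int r N2).
    by apply: Or32; apply: mS wXS; rewrite in_setI XI2.
  apply: Or33; apply: mB wXB; rewrite inE XI2 inE cX; apply/forallP => i.
  by case/setUP: (N2AS i); auto.
have dis (U V : {set {set 'I_n}}) : (forall X, X \in U -> X \notin V) -> #|U :|: V| = #|U| + #|V|.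
  move=> UV; rewrite cardsU; suff -> : U :&: V = set0 by rewrite cards0 subn0.
  by apply/setP => X; rewrite !inE; apply/andP => -[/UV/negbTE->].
rewrite !dis // => X.
- move=> /sA XI; apply/negP => /sS1; rewrite inE XI.
  by [].
- move=> XAS; have XI : X \in Int r N2 by by case/setUP: XAS => [/sA2|/sS2].
  by apply/negP => /sB; rewrite inE XI.
Qed.

Theorem corollary1 (n r : nat) (hn : 0 < n)
    (N1 N2 : 'I_n -> {set 'I_n})
    (neck1 : necklace r N1) (neck2 : necklace r N2)
    (std1 : forall i : 'I_n, i \in N1 i) (std2 : forall i : 'I_n, i \in N2 i)
    (le12 : necklace_le r N1 N2) :
  pure (Int r N2 :&: Out r N1) /\
  ((rk (Int r N2 :&: Out r N1))%:Z =
     r%:Z * (n%:Z - r%:Z) + 1 - (rk (Int r N1))%:Z - (rk (Out r N2))%:Z)%R.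
Proof.
(* Makes the truncated n - r of the count agree with the integer difference in the statement. *)
have rn : r <= n.
  by case: neck1 => /(_ (Ordinal hn)) <- _; rewrite -[X in _ <= X]card_ord max_card.
have total A S B : max_separated (Int r N1) A ->
    max_separated (Int r N2 :&: Out r N1) S -> max_separated (Out r N2) B ->
    #|A| + #|S| + #|B| = r * (n - r) + 1.
  move=> mA mS mB.
  have [mW <-] := max_separated_union hn neck1 neck2 std1 std2 le12 mA mS mB.
  exact: max_separated_card mW.
have [A mA] := max_separated_exists (Int r N1).
have [S mS] := max_separated_exists (Int r N2 :&: Out r N1).
have [B mB] := max_separated_exists (Out r N2).
have pI : pure (Int r N1).
  by move=> X Y mX mY; have := total X S B mX mS mB; have := total Y S B mY mS mB; clear; lia.
have pD : pure (Int r N2 :&: Out r N1).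
  by move=> X Y mX mY; have := total A X B mA mX mB; have := total A Y B mA mY mB; clear; lia.
have pO : pure (Out r N2).
  by move=> X Y mX mY; have := total A S X mA mS mX; have := total A S Y mA mS mY; clear; lia.
split=> //; rewrite (rk_pure pI mA) (rk_pure pD mS) (rk_pure pO mB).
rewrite (subzn rn); have := total A S B mA mS mB; clear; lia.
Qed.
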